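(* Let $\Omega\subseteq\mathbb R^n$ be open and suppose that $H\in C^1(\Omega\times\mathbb R\times\mathbb R^n\times\mathbb R^{n^{\otimes 2}}_s)$. If $u\in C^3(\Omega)$ is an absolute minimiser of $E_\infty$ on $\Omega$, then $u$ is a classical solution of $$H_X(\mathrm J^2u):\mathrm D\big(H(\mathrm J^2u)\big)\otimes\mathrm D\big(H(\mathrm J^2u)\big)=0\quad\text{on }\Omega,$$ that is, $$\sum_{i,j=1}^n H_{X_{ij}}(\mathrm J^2u)\,\mathrm D_i\big(H(\mathrm J^2u)\big)\,\mathrm D_j\big(H(\mathrm J^2u)\big)=0\quad\text{at every point of }\Omega.$$
   Context: $\mathbb R^{n^{\otimes 2}}_s$ is the space of symmetric $n\times n$ real matrices and $A:B=\operatorname{tr}(A^\top B)$. The arguments of $H$ are written $H(x,\eta,p,X)$, and $H_X$ (with components $H_{X_{ij}}$) is its derivative with respect to $X$. $\mathrm J^2u=(\cdot,u,\mathrm Du,\mathrm D^2u)$ is the second-order jet of $u$, so $H(\mathrm J^2u)(x)=H(x,u(x),\mathrm Du(x),\mathrm D^2u(x))$. The supremal functional is $$E_\infty(u,\mathcal O):=\operatorname*{ess\,sup}_{x\in\mathcal O}H\big(x,u(x),\mathrm Du(x),\mathrm D^2u(x)\big),\qquad u\in W^{2,\infty}(\Omega),\ \mathcal O\subseteq\Omega\text{ measurable}.$$ A function $u\in W^{2,\infty}(\Omega)$ is an absolute minimiser of $E_\infty$ on $\Omega$ if $E_\infty(u,\Omega')\le E_\infty(u+\varphi,\Omega')$ for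 all open $\Omega'\Subset\Omega$ and all $\varphi\in W^{2,\infty}_0(\Omega')$, where $W^{2,\infty}_0(\Omega')$ denotes the functions of $W^{2,\infty}(\Omega')$ that vanish together with their gradient on $\partial\Omega'$ (i.e. $W^{2,\infty}(\Omega')\cap W^{2,1}_0(\Omega')$), and $\Omega'\Subset\Omega$ means that $\overline{\Omega'}$ is a compact subset of $\Omega$. *)

(* Defs.v *)
From HB Require Import structures.
From mathcomp Require Import all_boot all_order all_algebra.
From mathcomp Require Import all_classical all_reals all_analysis.
From mathcomp Require Import ess_sup_inf.

Set Implicit Arguments.
Unset Strict Implicit.
Unset Printing Implicit Defensive.

Import Order.TTheory GRing.Theory Num.Theory.
Import numFieldNormedType.Exports.

Local Open Scope classical_set_scope.
Local Open Scope ring_scope.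

(* The product sigma-algebra on row vectors; it is the Borel sigma-algebra. *)

Definition rV_display : measure_display -> measure_display.
Proof. exact. Qed.

Section measurable_rV.
Context {R : realType} (n : nat).

Let coor (i : 'I_n) (v : 'rV[R]_n) : R := v ord0 i.

HB.instance Definition _ := @isMeasurable.Build
  (rV_display default_measure_display) 'rV[R]_n (g_sigma_preimage coor)
  (@sigma_algebra0 _ _ _) (@sigma_algebraC _ _) (@sigma_algebra_bigcup _ _ _).

Lemma measurable_coor (i : 'I_n) :
  measurable_fun [set: 'rV[R]_n] (fun v : 'rV[R]_n => v ord0 i).
Proof.
move=> _ Y mY; rewrite setTI; apply: sub_sigma_algebra => /=.
rewrite -bigcup_seq/=; exists i => /=; first by rewrite mem_index_enum.
by exists Y => //; rewrite setTI.
Qed.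

Lemma measurable_fun_coorP d (T : measurableType d) (f : T -> 'rV[R]_n) :
  (forall i, measurable_fun [set: T] (fun x => f x ord0 i)) ->
  measurable_fun [set: T] f.
Proof.
move=> mf _ Y mY; rewrite setTI.
suff: g_sigma_preimage coor `<=`
      [set B : set 'rV[R]_n | measurable (f @^-1` B)] by exact.
apply: smallest_sub.
  split => /=.
  - by rewrite preimage_set0.
  - by move=> B mB; rewrite setTD preimage_setC; exact: measurableC.
  - by move=> F mF; rewrite preimage_bigcup; exact: bigcup_measurable.
rewrite -bigcup_seq/= => B [i _ [C mC <-]] /=.
have := mf i measurableT C mC.
by rewrite !setTI.
Qed.

End measurable_rV.

(* n-dimensional Lebesgue measure, by induction on the dimension, as the image
   of the product measure under R * R^n -> R^(n+1). *)

Section lebesgue_rV.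
Context {R : realType}.

Definition row_cons n (p : measurableTypeR R * 'rV[R]_n) : 'rV[R]_n.+1 :=
  \row_i if unlift ord0 i is Some j then p.2 ord0 j else p.1.

Lemma measurable_row_cons n : measurable_fun setT (@row_cons n).
Proof.
apply: measurable_fun_coorP => i.
case: (unliftP ord0 i) => [j|] ->.
- rewrite (_ : (fun _ => _) = (fun v : 'rV[R]_n => v ord0 j) \o snd).
    by apply: measurableT_comp => //; exact: measurable_coor.
  by apply/funext => p; rewrite /= mxE liftK.
- rewrite (_ : (fun _ => _) = fst) //.
  by apply/funext => p; rewrite /= mxE unlift_none.
Qed.

Section step.
Variables (n : nat) (m : {sigma_finite_measure set 'rV[R]_n -> \bar R}).

Definition lebesgue_step : set 'rV[R]_n.+1 -> \bar R :=
  pushforward (lebesgue_measure \x m)%E (@row_cons n).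

Let mf := @measurable_row_cons n.

Let step0 : lebesgue_step set0 = 0%E.
Proof. by have := mf => ?; exact: measure0. Qed.

Let step_ge0 A : (0 <= lebesgue_step A)%E.
Proof. by have := mf => ?; exact: measure_ge0. Qed.

Let step_sigma_additive : semi_sigma_additive lebesgue_step.
Proof. by have := mf => ?; exact: measure_semi_sigma_additive. Qed.

HB.instance Definition _ := isMeasure.Build _ _ _ lebesgue_step
  step0 step_ge0 step_sigma_additive.

Let step_sigma_finite : sigma_finite setT lebesgue_step.
Proof.
have /sigma_finiteP[F [TF ndF Foo]] := sigma_finiteT (@lebesgue_measure R).
have /sigma_finiteP[G [TG ndG Goo]] := sigma_finiteT m.
pose tl (v : 'rV[R]_n.+1) : 'rV[R]_n := \row_j v ord0 (lift ord0 j).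
have mtl : measurable_fun setT tl.
  apply: measurable_fun_coorP => i.
  rewrite (_ : (fun _ => _) = (fun v : 'rV[R]_n.+1 => v ord0 (lift ord0 i))).
    exact: measurable_coor.
  by apply/funext => v; rewrite mxE.
exists (fun k => ((fun v : 'rV[R]_n.+1 => v ord0 ord0) @^-1` F k) `&`
                 (tl @^-1` G k)).
  apply/esym; rewrite -subTset => v _.
  have [k _ Fkv] : (\bigcup_i F i) (v ord0 ord0) by rewrite -TF.
  have [l _ Glv] : (\bigcup_i G i) (tl v) by rewrite -TG.
  exists (maxn k l) => //; split.
    by move/subsetPset: (ndF _ _ (leq_maxl k l)); apply.
  by move/subsetPset: (ndG _ _ (leq_maxr k l)); apply.
move=> k; have [mF Fk] := Foo k; have [mG Gk] := Goo k; split.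
  by apply: measurableI; rewrite -[X in measurable X]setTI;
    [exact: measurable_coor|exact: mtl].
rewrite /lebesgue_step /pushforward (_ : _ @^-1` _ = F k `*` G k).
  by rewrite product_measure1E// lte_mul_pinfty// ge0_fin_numE.
apply/seteqP; split => -[x w] /=.
all: have -> : tl (row_cons (x, w)) = w
  by apply/rowP => j; rewrite !mxE liftK.
all: by rewrite mxE unlift_none.
Qed.

HB.instance Definition _ := Measure_isSigmaFinite.Build _ _ _ lebesgue_step
  step_sigma_finite.

End step.

Fixpoint lebesgue_rV n : {sigma_finite_measure set 'rV[R]_n -> \bar R} :=
  if n is m.+1 then lebesgue_step (lebesgue_rV m) else \d_(0 : 'rV[R]_0).

End lebesgue_rV.
Arguments lebesgue_rV R n : clear implicits.

Lemma lebesgue_rV_box (R : realType) n (A : 'I_n -> set R) :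
  (forall i, measurable (A i)) ->
  lebesgue_rV R n [set v | forall i, A i (v ord0 i)] =
  (\prod_(i < n) lebesgue_measure (A i))%E.
Proof.
elim: n A => [|n IH] A mA.
  rewrite big_ord0 /= /dirac indicE mem_set//=.
  by case.
rewrite big_ord_recl -IH; last by move=> i; exact: mA.
have mB : measurable [set v : 'rV[R]_n | forall i, A (lift ord0 i) (v ord0 i)].
  have -> : [set v : 'rV[R]_n | forall i, A (lift ord0 i) (v ord0 i)] =
      \bigcap_(i in [set: 'I_n])
        ((fun v : 'rV[R]_n => v ord0 i) @^-1` A (lift ord0 i)).
    by apply/seteqP; split => v /= vA i => [_|]; exact: vA.
  apply: fin_bigcap_measurable => // i _; rewrite -[X in measurable X]setTI.
  by apply: measurable_coor; first exact: measurableT.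
rewrite -[RHS]product_measure1E//; last exact: mA.
rewrite /= /lebesgue_step /pushforward; congr (product_measure1 _ _ _).
apply/seteqP; split => -[x w] /=.
  move=> xwA; split=> [|i].
    by have := xwA ord0; rewrite mxE unlift_none.
  by have := xwA (lift ord0 i); rewrite mxE liftK.
case=> xA wA i; rewrite mxE.
by case: (unliftP ord0 i) => [j|] ->.
Qed.

(* C^k regularity of f on D by continuous iterated directional derivatives
   along the directions in the linear space L.  For D open and L = setT this
   is the usual C^k(D); for D a relatively open subset of L it is C^k(D) in the
   space L, whatever the values of f off L. *)
Fixpoint Ck (R : realType) (V : normedModType R) (L D : set V) (k : nat)
    (f : V -> R) : Prop :=
  {within D, continuous f} /\
  if k is k'.+1 then
    forall v, L v ->
      (forall a, D a -> derivable f a v) /\ Ck L D k' (fun a => 'D_v f a)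
  else True.

Section sobolev.
Context {R : realType} {n : nat}.
Implicit Types (U K : set 'rV[R]_n) (f g u phi : 'rV[R]_n -> R) (i j : 'I_n).

Local Notation mu := (lebesgue_rV R n).

Definition partial i f (x : 'rV[R]_n) : R := 'D_(delta_mx ord0 i) f x.

(* C_c^infty(U) *)
Definition test_function U phi : Prop :=
  (forall k, Ck setT setT k phi) /\
  exists K, [/\ compact K, K `<=` U & forall x, ~ K x -> phi x = 0].

Definition locally_integrable_on U f : Prop :=
  measurable_fun U f /\
  forall K, compact K -> K `<=` U -> mu.-integrable K (EFin \o f).

Definition is_weak_partial U i u g : Prop :=
  [/\ locally_integrable_on U u, locally_integrable_on U g &
      forall phi, test_function U phi ->
        \int[mu]_(x in U) (u x * partial i phi x) =
        - \int[mu]_(x in U) (g x * phi x)].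

(* A representative of the weak derivative, which is unique up to null
   subsets of U. *)
Definition weak_partial U i u : 'rV[R]_n -> R :=
  get [set g | is_weak_partial U i u g].

Definition weak_grad U u (x : 'rV[R]_n) : 'rV[R]_n :=
  \row_i weak_partial U i u x.

Definition weak_hess U u (x : 'rV[R]_n) : 'M[R]_n :=
  \matrix_(i, j) weak_partial U i (weak_partial U j u) x.

Definition in_Lp (p : \bar R) U f : Prop :=
  measurable_fun U f /\ ('N[mu]_p[EFin \o (f \_ U)] < +oo)%E.

Fixpoint in_Wkp (k : nat) (p : \bar R) U u : Prop :=
  in_Lp p U u /\
  if k is k'.+1 then
    forall i, exists2 g, is_weak_partial U i u g & in_Wkp k' p U g
  else True.

Fixpoint norm_Wkp (k : nat) (p : \bar R) U u : \bar R :=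
  ('N[mu]_p[EFin \o (u \_ U)] +
   if k is k'.+1 then \sum_(i < n) norm_Wkp k' p U (weak_partial U i u)
   else 0)%E.

(* The closure of C_c^infty(U) in W^{k,p}(U). *)
Definition in_Wkp0 (k : nat) (p : \bar R) U u : Prop :=
  in_Wkp k p U u /\
  exists2 psi : nat -> 'rV[R]_n -> R,
    forall m, test_function U (psi m) &
    norm_Wkp k p U (fun x => psi m x - u x) @[m --> \oo] --> 0%E.

Definition in_W2inf0 U u : Prop := in_Wkp 2 +oo%E U u /\ in_Wkp0 2 1%E U u.

End sobolev.

Section functional.
Context {R : realType} {n : nat}.
Implicit Types (U A Omega : set 'rV[R]_n) (u v : 'rV[R]_n -> R).

(* Arguments (x, eta, p, X) of H; only the values at symmetric X matter. *)
Definition jet : Type := ('rV[R]_n * R * 'rV[R]_n * 'M[R]_n)%type.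

Definition C1_hamiltonian Omega (H : jet -> R) : Prop :=
  @Ck R ('rV[R]_n * R * 'rV[R]_n * 'M[R]_n)%type
    [set a | a.2^T = a.2] [set a | Omega a.1.1.1 /\ a.2^T = a.2] 1 H.

(* H_X is the gradient for the inner product A : B on symmetric matrices, so
   its (i, j) entry is the derivative along the symmetric part of the matrix
   unit E_ij, and D_X H [Y] = H_X : Y for symmetric Y. *)
Definition H_X (H : jet -> R) (a : jet) : 'M[R]_n :=
  \matrix_(i, j)
    'D_((0, 0, 0, 2^-1 *: (delta_mx i j + delta_mx j i))
        : 'rV[R]_n * R * 'rV[R]_n * 'M[R]_n) H a.

Definition J2 u (x : 'rV[R]_n) : jet :=
  (x, u x, \row_i partial i u x, \matrix_(i, j) partial i (partial j u) x).

Definition weak_J2 U u (x : 'rV[R]_n) : jet :=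
  (x, u x, weak_grad U u x, weak_hess U u x).

(* E_infty(v, A) for v in W^{2,infty}(U) and a measurable subset A of U. *)
Definition E_inf (H : jet -> R) U v A : \bar R :=
  ess_sup (lebesgue_rV R n)
    (patch (fun=> -oo%E) A (fun x => (H (weak_J2 U v x))%:E)).

(* u + phi is considered as an element of W^{2,infty}(A). *)
Definition absolute_minimiser (H : jet -> R) Omega u : Prop :=
  in_Wkp 2 +oo%E Omega u /\
  forall A, open A -> compact (closure A) -> closure A `<=` Omega ->
  forall phi, in_W2inf0 A phi ->
    (E_inf H Omega u A <= E_inf H A (fun x => (u x + phi x)%R) A)%E.

End functional.
Arguments jet R n : clear implicits.

(* Main.v *)
(* Suppose that H_X(J2 u) : Dh (x) Dh, with h = H(J2 u), does not vanish at x0;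
   it then keeps a constant sign on a small closed Euclidean ball around x0.
   Perturb u by b (r - |x - x0|^2)^2, with b small and of the opposite sign.
   Where h attains its maximum M over the ball, Dh is nonzero, so the point is on
   the sphere and Dh is a multiple of x - x0; there the perturbation vanishes to
   first order and its Hessian is 8 b (x - x0) (x) (x - x0), hence H decreases to
   first order in b. By compactness sup H(J2(u + b phi)) <= M - b^2 on the ball,
   whereas E_inf(u) = M there, contradicting minimality. *)
From HB Require Import structures.
Require Import Defs.
From mathcomp Require Import all_boot all_order all_algebra.
From mathcomp Require Import all_classical all_reals all_analysis.
From mathcomp Require Import measurable_realfun ess_sup_inf.
From mathcomp Require Import ring lra.

Set Implicit Arguments.
Unset Strict Implicit.
Unset Printing Implicit Defensive.

Import Order.TTheory GRing.Theory Num.Theory.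
Import numFieldNormedType.Exports.

Local Open Scope classical_set_scope.
Local Open Scope ring_scope.

(** * Calculus in several variables *)

(** The ball is Euclidean, although row vectors carry the maximum norm, because its normal at a
    boundary point is the very direction along which the Hessian of the bump is concentrated; the
    multiplier relating that direction to Dh enters squared, so the sign of H_X : Dh (x) Dh is
    inherited. The slope of the decrease depends on the maximum point; a quadratic loss lies below
    every linear one for small parameters, so it can be required uniformly and local estimates can
    be glued. Three obstacles account for most of the length. The functional uses weak derivatives,
    chosen as arbitrary representatives, so the fundamental lemma of the calculus of variations is
    needed to identify them almost everywhere with classical ones. The bump is only a limit of test
    functions in W^{2,1}, since its Hessian does not vanish at the sphere. Finally, H is regular
    only along symmetric matrices; precomposition with the symmetric part turns it into a C^1
    function of unrestricted jets, to which ordinary calculus applies. *)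

Lemma is_derive_line (R : realType) (V : normedModType R) (f : V -> R) (x v : V)
    (s : R) :
  derivable f (x + s *: v) v ->
  is_derive s (1 : R) (fun t : R => f (x + t *: v)) ('D_v f (x + s *: v)).
Proof.
move=> df.
have E : (fun h : R => h^-1 *: (((fun t : R => f (x + t *: v)) \o shift s) (h *: (1 : R)) -
      f (x + s *: v))) =
    (fun h : R => h^-1 *: ((f \o shift (x + s *: v)) (h *: v) - f (x + s *: v))).
  apply/funext => h /=; congr (_ *: (f _ - _)).
  by rewrite [h *: 1]mulr1 scalerDl addrCA.
apply: DeriveDef; first by rewrite /derivable E.
by rewrite /derive E.
Qed.

(** The bound [|s| <= |t|] in place of an interval lets callers ignore the sign of [t]. Only
    derivability along [v] is asked, so the lemma applies before differentiability is known. *)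
Lemma MVT_line (R : realType) (V : normedModType R) (f : V -> R) (x v : V)
    (t : R) :
  (forall s, `|s| <= `|t| -> derivable f (x + s *: v) v) ->
  exists2 s, `|s| <= `|t| & f (x + t *: v) - f x = t * 'D_v f (x + s *: v).
Proof.
move=> df; set g := fun s : R => f (x + s *: v).
have dg s : `|s| <= `|t| -> is_derive s (1 : R) g ('D_v f (x + s *: v)).
  by move=> /df; exact: is_derive_line.
have cg a b : (forall s, s \in `[a, b] -> `|s| <= `|t|) ->
    {within `[a, b], continuous g}.
  move=> H; apply: derivable_within_continuous => s sab.
  by have [] := dg s (H s sab).
have [t0|t0|t0] := ltgtP t 0.
- have H s : s \in `[t, 0] -> `|s| <= `|t|.
    rewrite in_itv/= => /andP[ts s0]; rewrite !ler0_norm ?lerN2//.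
    exact: ltW.
  have [s st] := @MVT _ g (fun s => 'D_v f (x + s *: v)) t 0 t0
    (fun s hs => dg s (H s (subset_itv_oo_cc hs))) (cg _ _ H).
  rewrite /g scale0r addr0 => E.
  exists s; first by apply: H; exact: subset_itv_oo_cc.
  by rewrite -opprB E; ring.
- have H s : s \in `[0, t] -> `|s| <= `|t|.
    by rewrite in_itv/= => /andP[ts s0]; rewrite !ger0_norm// ltW.
  have [s st] := @MVT _ g (fun s => 'D_v f (x + s *: v)) 0 t t0
    (fun s hs => dg s (H s (subset_itv_oo_cc hs))) (cg _ _ H).
  rewrite /g scale0r addr0 => E.
  exists s; first by apply: H; exact: subset_itv_oo_cc.
  by rewrite E; ring.
- by exists 0; rewrite ?normr0// t0 scale0r addr0 subrr mul0r.
Qed.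

Lemma cvg_sumr (R : realType) (T I : Type) (F : set_system T) (r : seq I)
    (P : pred I) (f : I -> T -> R) (l : I -> R) : Filter F ->
  (forall i, P i -> f i x @[x --> F] --> l i) ->
  \sum_(i <- r | P i) f i x @[x --> F] --> \sum_(i <- r | P i) l i.
Proof.
move=> FF; apply: cvg_big.
by move=> /= p; apply: cvgD; [exact: cvg_fst|exact: cvg_snd].
Qed.

Section Ck.
Context {R : realType} {V : normedModType R}.
Implicit Types (L D : set V) (k : nat) (f : V -> R).

Lemma Ck_continuous D k f a :
  open D -> Ck setT D k f -> D a -> {for a, continuous f}.
Proof.
move=> oD; case: k => [|k] [+ _];
  by rewrite continuous_open_subspace// => cf Da; apply: cf; rewrite inE.
Qed.

Lemma Ck_derivable D k f a v : Ck setT D k.+1 f -> D a -> derivable f a v.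
Proof. by move=> [_ /(_ v)[]// df _] Da; exact: df. Qed.

Lemma Ck_pred L D k f : Ck L D k.+1 f -> Ck L D k f.
Proof.
elim: k f => [|k IH] f; first by case.
move=> [cf Df]; split => // v Lv; have [df Cf] := Df v Lv.
by split => //; exact: IH.
Qed.

Lemma Ck_derive D k f v : Ck setT D k.+1 f -> Ck setT D k ('D_v f).
Proof. by move=> [_ /(_ v)[]]. Qed.

End Ck.

(** * Differentiability from continuous partial derivatives, in finitely many coordinates *)

Section coordinates.
Context {R : realType} {V : normedModType R} {I : finType}.
Variables (e : I -> V) (c : I -> V -> R).
Hypothesis ce : forall w, w = \sum_i c i w *: e i.
Hypothesis c_lin : forall i k v w, c i (k *: v + w) = k * c i v + c i w.
Hypothesis c_le : forall i w, `|c i w| <= `|w|.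

(** The coordinates in [s] are changed one at a time; each leg is a mean value estimate along some
    [e i], costing at most [eps * |w|]. The last hypothesis keeps the whole polygonal path in the
    ball of radius [r]. *)
Let increment_bound (f : V -> R) (a w : V) (eps r : R) (s : seq I) :
  0 <= eps ->
  (forall x, `|x - a| < r -> forall i, derivable f x (e i)) ->
  (forall x, `|x - a| < r -> forall i, `|'D_(e i) f x - 'D_(e i) f a| <= eps) ->
  (\sum_(i <- s) `|e i|) * `|w| < r ->
  `|f (a + \sum_(i <- s) c i w *: e i) - f a
    - \sum_(i <- s) c i w * 'D_(e i) f a| <= (size s)%:R * eps * `|w|.
Proof.
move=> eps0 df Df; elim: s => [|i s IH].
  by rewrite !big_nil addr0 !subrr normr0 !mul0r.
rewrite !big_cons /= mulrDl => sr.
have psum : `|\sum_(j <- s) c j w *: e j| <= (\sum_(j <- s) `|e j|) * `|w|.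
  rewrite mulr_suml; apply: le_trans (ler_norm_sum _ _ _) _.
  by apply: ler_sum => j _; rewrite normrZ mulrC ler_wpM2l.
have near_r y : `|y| <= `|c i w| ->
    `|a + \sum_(j <- s) c j w *: e j + y *: e i - a| < r.
  move=> yc; apply: le_lt_trans sr.
  rewrite [_ - a]addrC !addrA addNr add0r addrC.
  apply: le_trans (ler_normD _ _) _; rewrite lerD// normrZ mulrC ler_wpM2l//.
  exact: le_trans yc (c_le _ _).
have [y yc E] := @MVT_line _ _ f (a + \sum_(j <- s) c j w *: e j) (e i) (c i w)
  (fun y hy => df _ (near_r y hy) i).
have {}IH := IH (le_lt_trans _ sr).
rewrite [_ *: e i + _]addrC addrA.
set A := a + \sum_(j <- s) c j w *: e j in E near_r IH *.
rewrite (_ : _ - _ - _ = (f A - f a - \sum_(j <- s) c j w * 'D_(e j) f a) +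
    c i w * ('D_(e i) f (A + y *: e i) - 'D_(e i) f a)); last first.
  by rewrite mulrBr -E; ring.
rewrite -natr1 mulrDl mul1r mulrDl; apply: le_trans (ler_normD _ _) _.
rewrite lerD//; last first.
  rewrite normrM mulrC; apply: ler_pM => //.
  exact: Df (near_r _ yc) i.
by apply: IH; rewrite lerDr mulr_ge0.
Qed.

(** [Ck] speaks of directional derivatives only; this is the bridge to the differential, hence to
    the chain rule. *)
Lemma continuous_partial_diff (f : V -> R) (a : V) :
  (\forall x \near a, forall i, derivable f x (e i)) ->
  (forall i, {for a, continuous (fun x => 'D_(e i) f x)}) ->
  differentiable f a /\
  forall w, 'd f a w = \sum_i c i w * 'D_(e i) f a.
Proof.
move=> df cf.
pose D (w : V) : R := \sum_i c i w * 'D_(e i) f a.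
have Dlin : linear D.
  move=> k x y; rewrite /D scaler_sumr -big_split/=; apply: eq_bigr => i _.
  by rewrite c_lin mulrDl -mulrA.
pose DL : {linear V -> R} :=
  HB.pack D (GRing.isLinear.Build _ _ _ _ D Dlin).
have Dbound w : `|D w| <= (\sum_i `|'D_(e i) f a|) * `|w|.
  rewrite mulr_suml; apply: le_trans (ler_norm_sum _ _ _) _.
  by apply: ler_sum => i _; rewrite normrM mulrC ler_wpM2l.
have Dcont : continuous DL.
  apply/linear_bounded_continuous/linear_boundedP.
  exists (\sum_i `|'D_(e i) f a|); split; first exact: num_real.
  move=> r Dr x; apply: le_trans (Dbound x) _.
  by rewrite ler_wpM2r// ltW.
have E : f \o shift a = cst (f a) + DL +o_ (0 : V) id.
  apply/eqaddoP => eps eps0.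
  (* The successor keeps [N] positive even without coordinates; errors [eps / N] per coordinate add
     up to at most [eps]. *)
  pose N : R := (size (enum I)).+1%:R.
  have N0 : 0 < N by rewrite ltr0n.
  have /nbhs_ballP[r /= r0 Hr] : \forall x \near a,
      (forall i, derivable f x (e i)) /\
      (forall i, `|'D_(e i) f x - 'D_(e i) f a| <= eps / N).
    near=> x; split; first by near: x.
    move=> i; rewrite distrC; move: i; near: x.
    apply: filter_forall => i.
    by have /cvgrPdist_le := cf i; apply; rewrite divr_gt0.
  pose M : R := \sum_(i <- enum I) `|e i| + 1.
  have M0 : 0 < M by rewrite ltr_pwDr// sumr_ge0.
  near=> w.
  have Mw : (\sum_(i <- enum I) `|e i|) * `|w| < r.
    rewrite (@le_lt_trans _ _ (M * `|w|))// ?ler_wpM2r// ?lerDl// mulrC.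
    rewrite -ltr_pdivlMr//; near: w.
    by apply: nbhs0_lt; rewrite divr_gt0.
  have := @increment_bound f a w (eps / N) r (enum I).
  have E1 : \sum_(i <- enum I) c i w *: e i = w by rewrite [RHS]ce big_enum.
  have E2 : \sum_(i <- enum I) c i w * 'D_(e i) f a = D w.
    by rewrite big_enum.
  rewrite E1 E2 => H; rewrite -![(_ + _) w]/(_ + _) -![(- _) w]/(- _)/=.
  rewrite opprD addrA [w + a]addrC; apply: le_trans (H _ _ _ Mw) _.
  - by rewrite divr_ge0// ltW.
  - by move=> x xa; apply: (Hr _ _).1; rewrite -ball_normE/= distrC.
  - by move=> x xa; apply: (Hr _ _).2; rewrite -ball_normE/= distrC.
  - rewrite ler_wpM2r// mulrA ler_pdivrMr// mulrC ler_wpM2l// ?ltW//.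
    by rewrite ltr_nat.
have dE := diff_unique Dcont E.
split; last by move=> w; rewrite dE.
by apply/diff_locallyP; rewrite dE.
Unshelve. all: by end_near. Qed.

Lemma Ck_diff (D : set V) (k : nat) (f : V -> R) (a : V) :
  open D -> Ck setT D k.+1 f -> D a ->
  differentiable f a /\
  forall w, 'd f a w = \sum_i c i w * 'D_(e i) f a.
Proof.
move=> oD Cf Da; have aD : \near a, D a by exact: open_nbhs_nbhs.
apply: continuous_partial_diff.
  by apply: filterS aD => x Dx i; exact: Ck_derivable Cf Dx.
by move=> i; apply: Ck_continuous Da => //; exact: Ck_derive Cf.
Qed.

Lemma continuous_coordinate i : continuous (c i).
Proof.
move=> v; apply/cvgrPdist_lt => r r0.
have : \forall w \near v, `|v - w| < r by exact: cvgr_dist_lt.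
apply: filterS => w; apply: le_lt_trans.
have -> : c i v - c i w = c i (v - w).
  have -> : v - w = (-1) *: w + v by rewrite scaleN1r addrC.
  by rewrite c_lin mulN1r addrC.
exact: c_le.
Qed.

(** Near [x] the differential is a finite sum of products of continuous functions. Joint continuity
    in point and direction replaces any use of operator norms. *)
Lemma continuous_diff_comp (D : set V) (k : nat) (f : V -> R)
    (X : topologicalType) (J w : X -> V) (x : X) :
  open D -> Ck setT D k.+1 f -> D (J x) ->
  {for x, continuous J} -> {for x, continuous w} ->
  {for x, continuous (fun y => 'd f (J y) (w y) : R)}.
Proof.
move=> oD Cf DJ cJ cw.
have Dn : \forall y \near x, D (J y).
  by apply: cJ; exact: open_nbhs_nbhs.
have E : \forall y \near x,
    \sum_i c i (w y) * 'D_(e i) f (J y) = 'd f (J y) (w y).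
  near=> y; apply/esym; apply: (Ck_diff oD Cf _).2; by near: y.
apply: cvg_trans (near_eq_cvg E) _.
rewrite /= -(nbhs_singleton E); apply: cvg_sumr => i _; apply: cvgM.
  exact: (continuous_comp cw (@continuous_coordinate i _)).
exact: (continuous_comp cJ (Ck_continuous oD (Ck_derive _ Cf) DJ)).
Unshelve. all: by end_near. Qed.

End coordinates.

Section row_vectors.
Context {R : realType} {n : nat}.

Lemma coord_le (w : 'rV[R]_n) i : `|w ord0 i| <= `|w|.
Proof.
rewrite [leRHS]/Num.Def.normr/= mx_normrE.
exact: (le_bigmax _ (fun ij : 'I_1 * 'I_n => `|w ij.1 ij.2|) (ord0, i)).
Qed.

Lemma rV_diff (U : set 'rV[R]_n) (k : nat) (f : 'rV[R]_n -> R) (x : 'rV[R]_n) :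
  open U -> Ck setT U k.+1 f -> U x ->
  differentiable f x /\
  forall w, 'd f x w = \sum_i w ord0 i * partial i f x.
Proof.
apply: (@Ck_diff _ _ _ (fun i => delta_mx ord0 i) (fun i w => w ord0 i)).
- by move=> w; exact: row_sum_delta.
- by move=> i l v w; rewrite !mxE.
- by move=> i w; exact: coord_le.
Qed.

Lemma continuous_mx m p (X : topologicalType) (M : X -> 'M[R]_(m, p)) (x : X) :
  (forall i j, {for x, continuous (fun y => M y i j)}) -> {for x, continuous M}.
Proof.
move=> cM; apply/cvg_ballP => e e0.
have : \forall y \near x, forall ij : 'I_m * 'I_p,
    ball (M x ij.1 ij.2) e (M y ij.1 ij.2).
  apply: filter_forall => -[i j] /=.
  by have /cvg_ballP := cM i j; apply.
by apply: filterS => y H; split => // i j; exact: (H (i, j)).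
Qed.

Lemma differentiable_mx m p (V : normedModType R) (M : V -> 'M[R]_(m, p)) (x : V) :
  (forall i j, differentiable (fun y => M y i j) x) -> differentiable M x.
Proof.
move=> dM.
have -> : M = \sum_(i < m) \sum_(j < p) (fun y => M y i j *: delta_mx i j).
  apply/funext => y; rewrite fct_sumE [LHS]matrix_sum_delta.
  by apply: eq_bigr => i _; rewrite fct_sumE.
apply: differentiable_sum => i; apply: differentiable_sum => j.
exact: differentiableZl.
Qed.

End row_vectors.

Lemma scale_pairE (R : realType) (V W : normedModType R) (k : R) (x : V) (y : W) :
  k *: (x, y) = (k *: x, k *: y).
Proof. by []. Qed.

Lemma add_pairE (R : realType) (V W : normedModType R) (x x' : V) (y y' : W) :
  (x, y) + (x', y') = (x + x', y + y').
Proof. by []. Qed.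

Lemma continuous_pair (X Y Z : topologicalType) (f : X -> Y) (g : X -> Z) (x : X) :
  {for x, continuous f} -> {for x, continuous g} ->
  {for x, continuous (fun y => (f y, g y))}.
Proof. by move=> cf cg; exact: cvg_pair. Qed.

(** * The space of jets as a space with coordinates *)

Section jets.
Context {R : realType} {n : nat}.
Implicit Types (a w : 'rV[R]_n * R * 'rV[R]_n * 'M[R]_n).

Local Notation jidx := ('I_n + unit + 'I_n + ('I_n * 'I_n))%type.

(** All matrix units are basis vectors, not only symmetric combinations: calculus takes place on
    unrestricted matrices. *)
Let jvec (i : jidx) : 'rV[R]_n * R * 'rV[R]_n * 'M[R]_n :=
  match i with
  | inl (inl (inl i)) => (delta_mx ord0 i, 0, 0, 0)
  | inl (inl (inr _)) => (0, 1, 0, 0)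
  | inl (inr i) => (0, 0, delta_mx ord0 i, 0)
  | inr (i, j) => (0, 0, 0, delta_mx i j)
  end.

Let jcoord (i : jidx) a : R :=
  match i with
  | inl (inl (inl i)) => a.1.1.1 ord0 i
  | inl (inl (inr _)) => a.1.1.2
  | inl (inr i) => a.1.2 ord0 i
  | inr (i, j) => a.2 i j
  end.

Let jvecE a : a = \sum_i jcoord i a *: jvec i.
Proof.
rewrite !big_sumType/=.
rewrite (big_pred1 tt); last by case.
have E1 (T : finType) (c : T -> R) (F : T -> 'rV[R]_n) :
    \sum_i c i *: (F i, 0 : R, 0 : 'rV[R]_n, 0 : 'M[R]_n) =
    (\sum_i c i *: F i, 0, 0, 0).
  elim/big_rec2 : _ => // i v y _ ->.
  by rewrite !scale_pairE !add_pairE !scaler0 !addr0.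
have E2 (T : finType) (c : T -> R) (F : T -> 'rV[R]_n) :
    \sum_i c i *: (0 : 'rV[R]_n, 0 : R, F i, 0 : 'M[R]_n) =
    (0, 0, \sum_i c i *: F i, 0).
  elim/big_rec2 : _ => // i v y _ ->.
  by rewrite !scale_pairE !add_pairE !scaler0 !addr0.
have E3 (T : finType) (c : T -> R) (F : T -> 'M[R]_n) :
    \sum_i c i *: (0 : 'rV[R]_n, 0 : R, 0 : 'rV[R]_n, F i) =
    (0, 0, 0, \sum_i c i *: F i).
  elim/big_rec2 : _ => // i v y _ ->.
  by rewrite !scale_pairE !add_pairE !scaler0 !addr0.
have -> : \sum_(p : 'I_n * 'I_n) (let (i, j) := p in a.2 i j) *:
      (let (i, j) := p in (0 : 'rV[R]_n, 0 : R, 0 : 'rV[R]_n, delta_mx i j : 'M[R]_n)) =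
    \sum_(p : 'I_n * 'I_n) a.2 p.1 p.2 *: (0, 0, 0, delta_mx p.1 p.2).
  by apply: eq_bigr => -[].
rewrite E1 E2 E3 -row_sum_delta -row_sum_delta.
rewrite -(pair_bigA _ (fun i j => a.2 i j *: delta_mx i j))/= -matrix_sum_delta.
rewrite !scale_pairE !add_pairE !scaler0 !addr0 !add0r [_ *: 1]mulr1.
by case: a => [[[? ?] ?] ?].
Qed.

Let jcoord_lin i k v w : jcoord i (k *: v + w) = k * jcoord i v + jcoord i w.
Proof. by case: i => [[[i|i]|i]|[i j]]; rewrite /= ?mxE. Qed.

Let jcoord_le i w : `|jcoord i w| <= `|w|.
Proof.
have fst_le (V W : normedModType R) (v : V * W) : `|v.1| <= `|v|.
  by rewrite [leRHS]/Num.Def.normr/= le_max lexx.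
have snd_le (V W : normedModType R) (v : V * W) : `|v.2| <= `|v|.
  by rewrite [leRHS]/Num.Def.normr/= le_max lexx orbT.
case: i => [[[i|i]|i]|[i j]] /=.
- apply: le_trans (coord_le _ _) _; apply: le_trans (fst_le _ _ w.1.1) _.
  by apply: le_trans (fst_le _ _ w.1) _; exact: fst_le.
- apply: le_trans (snd_le _ _ w.1.1) _.
  by apply: le_trans (fst_le _ _ w.1) _; exact: fst_le.
- apply: le_trans (coord_le _ _) _; apply: le_trans (snd_le _ _ w.1) _.
  exact: fst_le.
- apply: le_trans (snd_le _ _ w).
  rewrite [leRHS]/Num.Def.normr/= mx_normrE.
  exact: (le_bigmax _ (fun ij : 'I_n * 'I_n => `|w.2 ij.1 ij.2|) (i, j)).
Qed.

Lemma jet_diff (D : set ('rV[R]_n * R * 'rV[R]_n * 'M[R]_n)) (k : nat)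
    (f : 'rV[R]_n * R * 'rV[R]_n * 'M[R]_n -> R) a :
  open D -> Ck setT D k.+1 f -> D a -> differentiable f a.
Proof. by move=> oD Cf Da; have [] := Ck_diff jvecE jcoord_lin jcoord_le oD Cf Da. Qed.

Lemma continuous_jet_diff (D : set ('rV[R]_n * R * 'rV[R]_n * 'M[R]_n)) (k : nat)
    (f : 'rV[R]_n * R * 'rV[R]_n * 'M[R]_n -> R) (X : topologicalType)
    (J w : X -> 'rV[R]_n * R * 'rV[R]_n * 'M[R]_n) (x : X) :
  open D -> Ck setT D k.+1 f -> D (J x) ->
  {for x, continuous J} -> {for x, continuous w} ->
  {for x, continuous (fun y => 'd f (J y) (w y) : R)}.
Proof. move=> oD Cf.
exact: (continuous_diff_comp jvecE jcoord_lin jcoord_le oD Cf). Qed.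

End jets.

(** * Extension of H off the symmetric matrices *)

Section symmetrize.
Context {R : realType} {n : nat}.
Local Notation jetV := ('rV[R]_n * R * 'rV[R]_n * 'M[R]_n)%type.
Implicit Types (a v : jetV) (H : jet R n -> R) (Omega : set 'rV[R]_n).

(* [H \o symmetrize] extends [H], which matters only at symmetric matrices, to a
   [C^1] function on an open set of jets. *)
Definition symmetrize a : jetV := (a.1, 2^-1 *: (a.2 + a.2^T)).

Lemma symmetrize_sym a : (symmetrize a).2^T = (symmetrize a).2.
Proof. by rewrite /= linearZ/= linearD/= trmxK addrC. Qed.

Lemma symmetrize_id a : a.2^T = a.2 -> symmetrize a = a.
Proof.
case: a => b X /= XT; rewrite /symmetrize/= XT; congr pair.
by apply/matrixP => i j; rewrite !mxE; field.
Qed.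

Lemma symmetrize_lin (k : R) a v :
  symmetrize (k *: v + a) = k *: symmetrize v + symmetrize a.
Proof.
case: a v => [a A] [v B].
rewrite /symmetrize scale_pairE add_pairE/= scale_pairE add_pairE; congr pair.
by apply/matrixP => i j; rewrite !mxE; ring.
Qed.

Lemma continuous_symmetrize : continuous symmetrize.
Proof.
move=> a; apply: (@continuous_pair _ _ _ fst); first exact: cvg_fst.
apply: continuous_mx => i j.
have -> : (fun y : jetV => (2^-1 *: (y.2 + (y.2)^T)) i j) =
    (fun y => 2^-1 * (y.2 i j + y.2 j i)).
  by apply/funext => y; rewrite !mxE.
have c2 k l : {for a, continuous (fun y : jetV => y.2 k l)}.
  apply: (@continuous_comp _ _ _ snd (fun M : 'M[R]_n => M k l)).
    exact: cvg_snd.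
  exact: coord_continuous.
by apply: cvgM; [exact: cvg_cst|apply: cvgD; exact: c2].
Qed.

Lemma open_jet_domain Omega : open Omega -> open [set a : jetV | Omega a.1.1.1].
Proof.
move=> oO; apply: (open_comp (f := fun a : jetV => a.1.1.1)) oO => a _.
exact: (continuous_comp (continuous_comp (@cvg_fst _ _ _ _ _) (@cvg_fst _ _ _ _ _))
  (@cvg_fst _ _ _ _ _)).
Qed.

(** By linearity of [symmetrize] the two difference quotients coincide as functions of [h], so
    derivability and the value of the derivative transfer together, without a chain rule. *)
Lemma derive_symmetrize H a v :
  (fun h : R => h^-1 *: (((H \o symmetrize) \o shift a) (h *: v) - (H \o symmetrize) a)) =
  (fun h : R => h^-1 *: ((H \o shift (symmetrize a)) (h *: symmetrize v) - H (symmetrize a))).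
Proof. by apply/funext => h /=; rewrite symmetrize_lin. Qed.

(** [symmetrize] keeps the base point and lands in the symmetric jets, so continuity of [H] relative
    to them becomes continuity on an open set. *)
Lemma continuous_within_symmetrize Omega H : open Omega ->
  {within [set a : jetV | Omega a.1.1.1 /\ a.2^T = a.2], continuous (H : jetV -> R)} ->
  {within [set a : jetV | Omega a.1.1.1], continuous (H \o symmetrize)}.
Proof.
move=> oO cH; apply/subspace_continuousP => a Oa.
apply: (@cvg_comp _ _ _ symmetrize H _
  (within [set a : jetV | Omega a.1.1.1 /\ a.2^T = a.2] (nbhs (symmetrize a)))).
  move=> B; rewrite /within/= => /continuous_symmetrize/=.
  rewrite !nbhs_simpl /=; apply: filterS => b + Ob; apply.
  by split => //; exact: symmetrize_sym.
by move/subspace_continuousP : cH; apply; split => //; exact: symmetrize_sym.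
Qed.

Lemma Ck_symmetrize Omega H : open Omega -> C1_hamiltonian Omega H ->
  Ck setT [set a : jetV | Omega a.1.1.1] 1 (H \o symmetrize).
Proof.
move=> oO [cH DH]; split; first exact: continuous_within_symmetrize.
move=> v _; have [dH cDH] := DH (symmetrize v) (symmetrize_sym v).
split.
  move=> a Oa; rewrite /derivable derive_symmetrize; apply: dH.
  by split => //; exact: symmetrize_sym.
split=> //.
have -> : 'D_v (H \o symmetrize) = ('D_(symmetrize v) (H : jetV -> R)) \o symmetrize.
  by apply/funext => a; rewrite /derive derive_symmetrize.
apply: continuous_within_symmetrize => //.
exact: cDH.1.
Qed.

End symmetrize.

(** * Symmetry of second derivatives *)

Section Schwarz.
Context {R : realType} {V : normedModType R}.
Implicit Types (U : set V) (f : V -> R).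

Lemma is_derive_shift_arg f (x c v : V) : derivable f (x + c) v ->
  is_derive x v (fun y => f (y + c)) ('D_v f (x + c)).
Proof.
move=> df.
have E : (fun h : R => h^-1 *: (((fun y => f (y + c)) \o shift x) (h *: v) - f (x + c))) =
    (fun h : R => h^-1 *: ((f \o shift (x + c)) (h *: v) - f (x + c))).
  by apply/funext => h /=; rewrite addrA.
apply: DeriveDef; first by rewrite /derivable E.
by rewrite /derive E.
Qed.

(** The mean value theorem is used twice, first on the increment along [t *: w] regarded as a
    function along [v]. The second difference is symmetric in [v] and [w], so both orders of
    differentiation can be compared through it. *)
Lemma second_difference U f (x v w : V) (t : R) :
  Ck setT U 2 f ->
  (forall a b, `|a| <= `|t| -> `|b| <= `|t| -> U (x + a *: v + b *: w)) ->
  exists a b, [/\ `|a| <= `|t|, `|b| <= `|t| &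
    f (x + t *: v + t *: w) - f (x + t *: v) - f (x + t *: w) + f x =
    t ^+ 2 * 'D_w ('D_v f) (x + a *: v + b *: w)].
Proof.
move=> Cf Uab; pose F y := f (y + t *: w) - f y.
have U0 a : `|a| <= `|t| -> U (x + a *: v).
  by move=> at_; have := Uab a 0 at_; rewrite normr0 scale0r addr0; apply.
have dF s : `|s| <= `|t| -> is_derive (x + s *: v) v F
    ('D_v f (x + s *: v + t *: w) - 'D_v f (x + s *: v)).
  move=> st; apply: is_deriveB.
    by apply: is_derive_shift_arg; apply: Ck_derivable Cf _; exact: Uab.
  by apply: DeriveDef => //; apply: Ck_derivable Cf _; exact: U0.
have [a at_ E] := @MVT_line _ _ F x v t (fun s st => @ex_derive _ _ _ _ _ _ _ (dF s st)).
have [b bt E'] := @MVT_line _ _ ('D_v f) (x + a *: v) w t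
  (fun s st => Ck_derivable (Ck_derive v Cf) (Uab a s at_ st)).
exists a, b; split => //.
rewrite expr2 -mulrA -E' -(@derive_val _ _ _ _ _ _ _ (dF a at_)) -E /F.
by ring.
Qed.

(** The two mean value arguments produce different intermediate points, so equal values are only
    available at two points [p] and [q], both close to [x]. *)
Lemma continuous_eq_at (g1 g2 : V -> R) (x : V) :
  {for x, continuous g1} -> {for x, continuous g2} ->
  (forall r, 0 < r -> exists p q, [/\ ball x r p, ball x r q & g1 p = g2 q]) ->
  g1 x = g2 x.
Proof.
move=> c1 c2 H; apply/eqP; rewrite -subr_eq0 -normr_le0.
apply/ler_addgt0Pr => e e0; rewrite add0r.
have e20 : 0 < e / 2 by rewrite divr_gt0.
have [/cvgrPdist_le/(_ _ e20) h1 /cvgrPdist_le/(_ _ e20) h2] := (c1, c2).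
have /nbhs_ballP[r /= r0 Hr] : \forall t \near x,
    `|g1 x - g1 t| <= e / 2 /\ `|g2 x - g2 t| <= e / 2 by exact: filterI.
have [p [q [xp xq pq]]] := H _ r0.
rewrite (_ : _ - _ = (g1 x - g1 p) - (g2 x - g2 q)); last by rewrite pq; ring.
rewrite (le_trans (ler_normB _ _))// [leRHS]splitr lerD//.
- exact: (Hr _ xp).1.
- exact: (Hr _ xq).2.
Qed.

Lemma Schwarz U f (x v w : V) : open U -> Ck setT U 2 f -> U x ->
  'D_v ('D_w f) x = 'D_w ('D_v f) x.
Proof.
move=> oU Cf Ux; apply: (@continuous_eq_at ('D_v ('D_w f)) ('D_w ('D_v f))).
- exact: Ck_continuous oU (Ck_derive v (Ck_derive w Cf)) Ux.
- exact: Ck_continuous oU (Ck_derive w (Ck_derive v Cf)) Ux.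
move=> r0 r00.
have /nbhs_ballP[r1 /= r10 Hr1] := open_nbhs_nbhs (conj oU Ux).
pose r := Num.min r0 r1; have r_gt0 : 0 < r by rewrite lt_min r00.
(* Since [t * M = r / 2], all points [x + a *: v + b *: w] with [|a|, |b| <= t] stay in the ball of
   radius [r]. *)
pose M := `|v| + `|w| + 1; have M0 : 0 < M by rewrite ltr_pwDr// addr_ge0.
pose t := r / 2 / M; have t0 : 0 < t by rewrite !divr_gt0.
have near_x a b v' w' : `|v'| + `|w'| = `|v| + `|w| ->
    `|a| <= `|t| -> `|b| <= `|t| -> ball x r (x + a *: v' + b *: w').
  move=> vw at_ bt; rewrite -ball_normE/= -addrA opprD addNKr normrN.
  apply: le_lt_trans (ler_normD _ _) _; rewrite !normrZ.
  apply: (@le_lt_trans _ _ (`|t| * (`|v'| + `|w'|))).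
    by rewrite mulrDr lerD// ler_wpM2r.
  rewrite vw gtr0_norm// (@le_lt_trans _ _ (t * M))//.
    by rewrite ler_wpM2l ?ltW// ltrDl.
  by rewrite /t divfK ?gt_eqF// ltr_pdivrMr// ltr_pMr// ltr1n.
have ball0 y : ball x r y -> ball x r0 y.
  by apply: le_ball; rewrite ge_min lexx.
have ballU y : ball x r y -> U y.
  by move=> xy; apply: Hr1; apply: le_ball xy; rewrite ge_min lexx orbT.
have vw := erefl (`|v| + `|w|); have wv := addrC `|w| `|v|.
have [a [b [at_ bt E]]] := second_difference Cf
  (fun a b ha hb => ballU _ (near_x a b v w vw ha hb)).
have [c [d [ct dt E']]] := second_difference Cf
  (fun a b ha hb => ballU _ (near_x a b w v wv ha hb)).
exists (x + c *: w + d *: v), (x + a *: v + b *: w); split.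
- exact: ball0 (near_x _ _ _ _ wv ct dt).
- exact: ball0 (near_x _ _ _ _ vw at_ bt).
have t2 : t ^+ 2 != 0 by rewrite expf_neq0// gt_eqF.
apply: (mulfI t2); refine (etrans (esym E') (etrans _ E)).
by rewrite -[x + t *: w + t *: v]addrAC; ring.
Qed.

End Schwarz.

(** * The jet of a C^3 function *)

Section J2.
Context {R : realType} {n : nat}.
Variables (U : set 'rV[R]_n) (u : 'rV[R]_n -> R).
Hypotheses (oU : open U) (Cu : Ck setT U 3 u).

(** Ensures that [H] is evaluated at symmetric matrices, where it agrees with its extension. *)
Lemma J2_sym x : U x -> (J2 u x).2^T = (J2 u x).2.
Proof.
move=> Ux; apply/matrixP => i j; rewrite !mxE.
apply: Schwarz oU _ Ux.
exact: Ck_pred Cu.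
Qed.

Lemma continuous_J2 x : U x -> {for x, continuous (J2 u)}.
Proof.
move=> Ux; apply: continuous_pair.
  apply: continuous_pair.
    apply: continuous_pair; first exact: cvg_id.
    exact: Ck_continuous oU Cu Ux.
  apply: continuous_mx => i j.
  have -> : (fun y => (\row_i partial i u y) i j) = partial j u.
    by apply/funext => y; rewrite mxE.
  exact: Ck_continuous oU (Ck_derive _ Cu) Ux.
apply: continuous_mx => i j.
have -> : (fun y => (\matrix_(i, j) partial i (partial j u) y) i j) =
    partial i (partial j u).
  by apply/funext => y; rewrite mxE.
exact: Ck_continuous oU (Ck_derive _ (Ck_derive _ Cu)) Ux.
Qed.

(** The differential of [J2 u] at [x] along [v]. Its last entry consists of third derivatives, which
    is where C^3 enters. *)
Definition dJ2 (v x : 'rV[R]_n) : 'rV[R]_n * R * 'rV[R]_n * 'M[R]_n :=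
  (v, 'D_v u x, \row_i 'D_v (partial i u) x,
   \matrix_(i, j) 'D_v (partial i (partial j u)) x).

Lemma J2_diff x : U x -> differentiable (J2 u) x /\
  forall v, 'd (J2 u) x v = dJ2 v x.
Proof.
move=> Ux.
have d0 : differentiable u x by exact: (rV_diff oU Cu Ux).1.
have d1 i : differentiable (partial i u) x.
  exact: (rV_diff oU (Ck_derive _ Cu) Ux).1.
have d2 i j : differentiable (partial i (partial j u)) x.
  exact: (rV_diff oU (Ck_derive _ (Ck_derive _ Cu)) Ux).1.
have E1 i j : (fun y => (\row_i partial i u y : 'rV[R]_n) i j) = partial j u.
  by apply/funext => y; rewrite mxE.
have E2 i j : (fun y => (\matrix_(i, j) partial i (partial j u) y : 'M[R]_n) i j) =
    partial i (partial j u).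
  by apply/funext => y; rewrite mxE.
have D1 : differentiable (fun y => \row_i partial i u y : 'rV[R]_n) x.
  by apply: differentiable_mx => i j; rewrite E1.
have D2 : differentiable (fun y => \matrix_(i, j) partial i (partial j u) y : 'M[R]_n) x.
  by apply: differentiable_mx => i j; rewrite E2.
have P1 : differentiable (fun y => (y, u y)) x by exact: differentiable_pair.
have P2 : differentiable (fun y => (y, u y, \row_i partial i u y : 'rV[R]_n)) x.
  exact: differentiable_pair.
split; first exact: differentiable_pair.
move=> v; rewrite /dJ2.
rewrite (diff_pair P2 D2) (diff_pair P1 D1).
rewrite (@diff_pair _ _ _ _ id u)//.
congr (_, _, _, _).
- by rewrite diff_val.
- by rewrite (deriveE v d0).
- rewrite -(deriveE v D1) derive_mx; last exact: diff_derivable.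
  by apply/matrixP => i j; rewrite !mxE E1.
- rewrite -(deriveE v D2) derive_mx; last exact: diff_derivable.
  apply/matrixP => i j; rewrite [LHS]mxE [RHS]mxE.
  exact: (congr1 (fun g => 'D_v g x) (E2 i j)).
Qed.

Lemma continuous_dJ2 v x : U x -> {for x, continuous (dJ2 v)}.
Proof.
move=> Ux; apply: continuous_pair.
  apply: continuous_pair.
    apply: continuous_pair; first exact: (@cst_continuous _ _ v).
    exact: Ck_continuous oU (Ck_derive _ Cu) Ux.
  apply: continuous_mx => i j.
  have -> : (fun y => (\row_i 'D_v (partial i u) y : 'rV[R]_n) i j) = 'D_v (partial j u).
    by apply/funext => y; rewrite mxE.
  exact: Ck_continuous oU (Ck_derive _ (Ck_derive _ Cu)) Ux.
apply: continuous_mx => i j.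
have -> : (fun y => (\matrix_(i, j) 'D_v (partial i (partial j u)) y : 'M[R]_n) i j) =
    'D_v (partial i (partial j u)).
  by apply/funext => y; rewrite mxE.
exact: Ck_continuous oU (Ck_derive _ (Ck_derive _ (Ck_derive _ Cu))) Ux.
Qed.

End J2.

Lemma nbhs_right_pos_lt (R : realType) (r : R) : 0 < r ->
  \forall d \near 0^'+, 0 < d < r.
Proof.
move=> r0; near=> d; apply/andP; split; near: d; first exact: nbhs_right_gt.
exact: nbhs_right_lt.
Unshelve. all: by end_near. Qed.

(** [A] is the slope at a maximum point and [B] the one at a nearby point, so [B <= A / 2]; as
    [A / 2 < - d], the change [d * B] is below [- d ^+ 2]. *)
Lemma decrease_bound (R : realFieldType) (A B M d g g' : R) :
  A < 0 -> 0 < d -> d < - A / 2 -> g <= M -> `|A - B| <= - A / 2 ->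
  g' - g = d * B -> g' <= M - d ^+ 2.
Proof.
move=> A0 d0 dA gM; rewrite ler_norml => /andP[AB _] gg'.
have {}AB : B <= A / 2 by lra.
nra.
Qed.

(** * Decreasing the maximum of G(J) over a compact set *)

Section deformation.
Context {R : realType} {n : nat}.
Local Notation jetV := ('rV[R]_n * R * 'rV[R]_n * 'M[R]_n)%type.
Variables (G : jetV -> R) (D : set jetV).
Hypotheses (oD : open D) (CG : Ck setT D 1 G).

(** Each [z] in [K] has a neighbourhood and a range of [d] on which the bound holds: below the
    maximum by continuity, at the maximum by the negative slope. The bound [M - d ^+ 2] does not
    depend on [z], so compactness makes the range of [d] uniform. *)
Lemma deformation (J P : 'rV[R]_n -> jetV) (K : set 'rV[R]_n) (M : R) :
  compact K ->
  (forall x, K x -> [/\ D (J x), {for x, continuous J} & {for x, continuous P}]) ->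
  (forall x, K x -> G (J x) <= M) ->
  (forall x, K x -> G (J x) = M -> 'd G (J x) (P x) < 0) ->
  \forall d \near 0^'+, forall x, K x -> G (J x + d *: P x) <= M - d ^+ 2.
Proof.
move=> /compact_near_coveringP cK KJP GM dG.
have := @cK R (0^'+) (fun d x => K x -> G (J x + d *: P x) <= M - d ^+ 2).
move=> H; have {H} : \forall d \near (0 : R)^'+,
    K `<=` (fun x => K x -> G (J x + d *: P x) <= M - d ^+ 2); last first.
  by apply: filterS => d + x Kx; apply.
apply: H => z Kz; have [Dz cJ cP] := KJP z Kz.
pose c (p : 'rV[R]_n * R) := J p.1 + p.2 *: P p.1.
have cJ1 : {for (z, 0 : R), continuous (fun p : 'rV[R]_n * R => J p.1)}.
  exact: (@continuous_comp _ _ _ fst J (z, 0 : R) cvg_fst cJ).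
have cP1 : {for (z, 0 : R), continuous (fun p : 'rV[R]_n * R => P p.1)}.
  exact: (@continuous_comp _ _ _ fst P (z, 0 : R) cvg_fst cP).
have c0 : c (z, 0) = J z by rewrite /c/= scale0r addr0.
have cc : {for (z, 0 : R), continuous c}.
  apply: cvgD; first exact: cJ1.
  by apply: cvgZ; [exact: cvg_snd|exact: cP1].
have Dc : \forall p \near (z, 0 : R), D (c p).
  by apply: cc; rewrite c0; exact: open_nbhs_nbhs.
have [GzM|GzM] := ltP (G (J z)) M.
  (* Strictly below the maximum: half of the gap survives nearby, and [d < 1], [d < k] make [d ^+ 2]
     smaller than that half. *)
  pose k := (M - G (J z)) / 2.
  have k0 : 0 < k by rewrite divr_gt0// subr_gt0.
  have cG : {for (z, 0 : R), continuous (G \o c)}.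
    apply: continuous_comp; first exact: cc.
    by rewrite c0; exact: Ck_continuous oD CG Dz.
  have /cvgrPdist_le/(_ _ k0)/nbhs_ballP[r /= r0 Hr] := cG.
  exists (ball z r, [set d | 0 < d < Num.min r (Num.min 1 k)]).
    split; first exact: nbhsx_ballx.
    by apply: nbhs_right_pos_lt; rewrite !lt_min r0 k0 ltr01.
  move=> [x d] /= [zx /andP[d0]]; rewrite !lt_min => /and3P[dr d1 dk] _.
  have /Hr : ball (z, 0 : R) r (x, d).
    by split => //=; rewrite -ball_normE/= sub0r normrN gtr0_norm.
  rewrite /= c0 ler_norml => /andP[+ _]; rewrite -/(c (x, d)) => h.
  have Gk : G (c (x, d)) <= M - k by move: h; rewrite /k; lra.
  by rewrite (le_trans Gk)// lerD2l lerN2; nra.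
(* At a maximum point: the slope remains at most half of its negative value at [z] for all [(x, s)]
   near [(z, 0)], in particular at the intermediate point of the mean value theorem. *)
have {}GzM : G (J z) = M by apply/eqP; rewrite eq_le GM.
have dz : 'd G (c (z, 0)) (P z) < 0 by rewrite c0; exact: dG.
pose k := - 'd G (c (z, 0)) (P z) / 2.
have k0 : 0 < k by rewrite divr_gt0// oppr_gt0.
have cG : {for (z, 0 : R), continuous (fun p => 'd G (c p) (P p.1) : R)}.
  by apply: (continuous_jet_diff oD CG _ cc cP1); rewrite c0.
have /cvgrPdist_le/(_ _ k0) Hk := cG.
have /nbhs_ballP[r /= r0 Hr] : \forall p \near (z, 0 : R),
    D (c p) /\ `|'d G (c (z, 0)) (P (z, 0 : R).1) - 'd G (c p) (P p.1)| <= k.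
  exact: filterI.
exists (ball z r, [set d | 0 < d < Num.min r k]).
  split; first exact: nbhsx_ballx.
  by apply: nbhs_right_pos_lt; rewrite lt_min r0.
move=> [x d] /= [zx /andP[d0]]; rewrite !lt_min => /andP[dr dk] Kx.
have near_s s : `|s| <= `|d| -> ball (z, 0 : R) r (x, s).
  move=> sd; split => //=; rewrite -ball_normE/= sub0r normrN.
  by rewrite (le_lt_trans sd)// gtr0_norm.
have [s sd E] := @MVT_line _ _ G (J x) (P x) d
  (fun s sd => diff_derivable (jet_diff oD CG (Hr _ (near_s _ sd)).1)).
have [Ds /=] := Hr _ (near_s s sd).
have {}E : G (J x + d *: P x) - G (J x) = d * 'd G (c (x, s)) (P x) :=
  etrans E (congr1 ( *%R d) (deriveE (P x) (jet_diff oD CG Ds))).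
move=> hk; exact: (decrease_bound dz d0 dk (GM x Kx) hk E).
Qed.

End deformation.

(** * First-order condition at a maximum over a Euclidean ball *)

Section ball_maximum.
Context {R : realType} {n : nat}.
Implicit Types (x y v w : 'rV[R]_n).

(** The Euclidean inner product. The norm of row vectors is the maximum norm, so Euclidean balls are
    written as sublevel sets of [dotr]. *)
Definition dotr v w : R := \sum_i v ord0 i * w ord0 i.

Lemma dotrC v w : dotr v w = dotr w v.
Proof. by apply: eq_bigr => i _; rewrite mulrC. Qed.

Lemma dotr_linl (k : R) v w y : dotr (k *: v + w) y = k * dotr v y + dotr w y.
Proof.
rewrite /dotr mulr_sumr -big_split/=; apply: eq_bigr => i _.
by rewrite !mxE mulrDl mulrA.
Qed.

Lemma dotr_linr (k : R) v w y : dotr y (k *: v + w) = k * dotr y v + dotr y w.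
Proof. by rewrite dotrC dotr_linl !(dotrC y). Qed.

Lemma dotr_ge0 v : 0 <= dotr v v.
Proof. by apply: sumr_ge0 => i _; rewrite -expr2 sqr_ge0. Qed.

Lemma dotr_eq0 v : dotr v v = 0 -> v = 0.
Proof.
move=> /eqP; rewrite psumr_eq0; last by move=> i _; rewrite -expr2 sqr_ge0.
move=> /allP v0; apply/rowP => i; rewrite mxE.
have := v0 i (mem_index_enum _).
by rewrite -expr2 sqrf_eq0 => /eqP.
Qed.

Lemma derive_le0 (h : 'rV[R]_n -> R) z v : derivable h z v ->
  (\forall t \near 0^'+, h (t *: v + z) <= h z) -> 'D_v h z <= 0.
Proof.
move=> dh hz; rewrite leNgt; apply/negP => D0.
have cD := cvg_dnbhs_at_right dh.
have : \forall t \near (0 : R)^'+, h (t *: v + z) <= h z /\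
    (0 < t /\ 0 < t^-1 * (h (t *: v + z) - h z)).
  apply: filterI => //; apply: filterI; first exact: nbhs_right_gt.
  exact: cvgr_gt cD _ D0.
move=> /filter_ex[t [ht [t0]]]; rewrite pmulr_rgt0 ?invr_gt0// subr_gt0 => /lt_le_trans/(_ ht).
by rewrite ltxx.
Qed.

(** Every direction [v] pointing into the ball satisfies [dotr v g <= 0]. At an interior point
    [v = g] is allowed, which would force [g = 0]; on the sphere the tangential part of [g], tilted
    slightly inwards, is allowed, so it must vanish. Here [r] is the squared radius. *)
Lemma max_ball_gradient (h : 'rV[R]_n -> R) (x z g : 'rV[R]_n) (r : R) :
  0 < r -> differentiable h z -> (forall v, 'd h z v = dotr v g) -> g != 0 ->
  dotr (z - x) (z - x) <= r ->
  (forall y, dotr (y - x) (y - x) <= r -> h y <= h z) ->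
  dotr (z - x) (z - x) = r /\ exists k, g = k *: (z - x).
Proof.
move=> r0 dh dhg g0 zr hz.
set y := z - x in zr *.
have step v : dotr y y < r \/ dotr y v < 0 -> dotr v g <= 0.
  move=> yv; rewrite -dhg -deriveE//; apply: derive_le0; first exact: diff_derivable.
  have [d d0 Hd] : exists2 d, 0 < d & forall t, 0 < t < d ->
      dotr (t *: v + y) (t *: v + y) <= r.
    have a0 := dotr_ge0 v; have b0 := normr_ge0 (dotr y v).
    have [bl bu] : - `|dotr y v| <= dotr y v /\ dotr y v <= `|dotr y v|.
      by apply/andP; rewrite -ler_norml.
    case: yv => [yr|yv].
      (* For [t <= 1] the squared length grows by at most [t * (dotr v v + 2 * |dotr y v|)]; the
         final [1] keeps the denominator positive. *)
      exists (Num.min 1 ((r - dotr y y) / (dotr v v + 2 * `|dotr y v| + 1))).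
        by rewrite lt_min ltr01 divr_gt0 ?subr_gt0// ltr_wpDl// addr_ge0// mulr_ge0.
      move=> t /andP[t0]; rewrite lt_min => /andP[t1].
      rewrite ltr_pdivlMr; last by rewrite ltr_wpDl// addr_ge0// mulr_ge0.
      rewrite dotr_linl !dotr_linr (dotrC v y) => hh.
      have h1 : t * (t * dotr v v) <= t * dotr v v.
        by apply: ler_wpM2l; [exact: ltW|apply: ler_piMl => //; exact: ltW].
      have h2 : t * dotr y v <= t * `|dotr y v| by rewrite ler_wpM2l// ltW.
      by lra.
    (* Here the negative first-order term wins, because [t * dotr v v] stays below [- dotr y v]. *)
    exists (- dotr y v / (dotr v v + 1)).
      by rewrite divr_gt0 ?oppr_gt0// ltr_wpDl.
    move=> t /andP[t0]; rewrite ltr_pdivlMr ?ltr_wpDl//.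
    rewrite dotr_linl !dotr_linr (dotrC v y) => hh.
    have h1 : t * (t * (dotr v v + 1)) <= t * - dotr y v.
      by apply: ler_wpM2l; exact: ltW.
    by nra.
  apply: filterS (nbhs_right_pos_lt d0) => t td; apply: hz.
  by rewrite -addrA; exact: Hd.
have yr : dotr y y = r.
  apply/eqP; rewrite eq_le zr/= leNgt; apply/negP => yr.
  move/negP : g0; apply; apply/eqP/dotr_eq0/eqP; rewrite eq_le dotr_ge0 andbT.
  by apply: step; left.
split => //; exists (dotr g y / r).
set k := dotr g y / r; pose w := g - k *: y.
have wE : w = (- k) *: y + g by rewrite scaleNr addrC.
have wy : dotr w y = 0.
  by rewrite wE dotr_linl yr /k mulNr divfK ?gt_eqF// addNr.
have wg : dotr w g <= 0.
  apply/ler_addgt0Pr => e e0; rewrite add0r.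
  (* [w] itself is only tangent; the tilt [- t *: y] makes it point inwards at a cost
     [t * dotr y g <= e]. *)
  pose t := e / (`|dotr y g| + 1).
  have t0 : 0 < t by rewrite divr_gt0// ltr_pwDr.
  have := step (- t *: y + w); rewrite dotr_linl dotr_linr (dotrC y w) wy addr0 yr.
  rewrite mulNr oppr_lt0 mulr_gt0// => /(_ (or_intror isT)) h1.
  have h2 : t * dotr y g <= e.
    rewrite /t mulrAC ler_pdivrMr ?ltr_pwDr// ler_wpM2l// ltW//.
    by rewrite (le_lt_trans (ler_norm _))// ltrDl.
  by move: h1 h2; rewrite mulNr; lra.
have : dotr w w <= 0.
  by rewrite {2}wE dotr_linr wy mulr0 add0r.
move=> ww; have /dotr_eq0 w0 : dotr w w = 0.
  by apply/eqP; rewrite eq_le ww dotr_ge0.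
by apply/eqP; rewrite -subr_eq0 -/w w0.
Qed.

End ball_maximum.

(** * Smooth functions built from flat exponentials *)

Section flat.
Context {R : realType}.
Implicit Types (p : {poly R}) (a t : R).

(* This form is stable under differentiation in [t]: [dflat p a] replaces [p]. *)
Definition flat p a t : R := if 0 < t then p.[t^-1] * expR (- a / t) else 0.

(** With [s = 1 / t], the chain rule multiplies the derivative in [s] of [p(s) exp(- a s)] by
    [- s ^ 2]. *)
Definition dflat p a : {poly R} := 'X^2 * (a *: p - p^`()).

Let is_derive_inv t : t != 0 -> is_derive t (1 : R) (fun s => s^-1) (- t ^- 2).
Proof.
move=> t0; apply: DeriveDef.
  by apply: (@derivableV _ _ (@id R)).
by rewrite (@deriveV _ _ (@id R))// derive_id [LHS]mulr1.
Qed.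

Let flat_pos p a t : 0 < t ->
  is_derive t (1 : R) (fun s => p.[s^-1] * expR (- a / s)) ((dflat p a).[t^-1] * expR (- a / t)).
Proof.
move=> t0; have dV := is_derive_inv (lt0r_neq0 t0).
have d1 : is_derive t (1 : R) (horner p \o (fun s => s^-1)) (p^`().[t^-1] * (- t ^- 2)).
  exact: is_derive1_comp.
have d2 : is_derive t (1 : R) (expR \o (fun s => - a / s)) (expR (- a / t) * (- a * (- t ^- 2))).
  apply: is_derive1_comp.
have := @is_deriveM _ _ _ _ t 1 _ _ d1 d2.
move=> d; apply: (is_derive_eq d) => /=.
have scE (x y : R) : x *: y = x * y by [].
rewrite !scE /dflat hornerM hornerXn hornerD hornerN hornerZ exprVn.
by ring.
Qed.

Let poly_bound p : exists2 C : R, 0 <= C & forall s, 1 <= s ->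
  `|p.[s]| <= C * s ^+ size p.
Proof.
exists (\sum_(i < size p) `|p`_i|); first exact: sumr_ge0.
move=> s s1; rewrite horner_coef mulr_suml; apply: le_trans (ler_norm_sum _ _ _) _.
apply: ler_sum => i _; rewrite normrM ler_wpM2l// ger0_norm ?exprn_ge0//; last first.
  by rewrite (le_trans _ s1).
by rewrite ler_weXn2l// ltnW.
Qed.

(** A quadratic bound yields a zero derivative at the origin. It comes from
    [exp(x) = exp(x / N) ^ N >= (x / N) ^ N] at [x = a / t]. *)
Let flat_small p a : 0 < a -> exists2 C : R, 0 <= C & forall t, 0 < t <= 1 ->
  `|flat p a t| <= C * t ^+ 2.
Proof.
move=> a0; have [C C0 HC] := poly_bound p.
(* [size p] powers of [t] absorb the growth of [p] at infinity and two more remain. *)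
pose N := (size p + 2)%N; pose K := (a / N%:R) ^+ N.
have N0 : 0 < N%:R :> R by rewrite ltr0n /N addn2.
have K0 : 0 < K by rewrite exprn_gt0// divr_gt0.
exists (C / K); first by rewrite divr_ge0// ltW.
move=> t /andP[t0 t1]; rewrite /flat t0 normrM (ger0_norm (expR_ge0 _)).
have s1 : 1 <= t^-1 by rewrite invf_ge1.
have s0 : 0 < t^-1 by rewrite invr_gt0.
have eK : K * t^-1 ^+ N <= expR (a / t).
  have -> : a / t = N%:R * (a / N%:R * t^-1).
    by field; rewrite !gt_eqF.
  rewrite expRM_natl -exprMn lerXn2r// ?nnegrE ?expR_ge0//.
    by rewrite !mulr_ge0// ltW// invr_gt0.
  by apply: le_trans (expR_ge1Dx _); rewrite lerDr.
have eK0 : 0 < K * t^-1 ^+ N by rewrite mulr_gt0// exprn_gt0.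
rewrite mulNr expRN; apply: (@le_trans _ _ (C * t^-1 ^+ size p / (K * t^-1 ^+ N))).
  apply: ler_pM; [exact: normr_ge0|by rewrite invr_ge0 expR_ge0|exact: HC|].
  by rewrite lef_pV2// posrE expR_gt0.
rewrite /N exprD !exprVn; rewrite le_eqVlt; apply/orP; left; apply/eqP; field.
by rewrite !gt_eqF// exprn_gt0.
Qed.

(** Flatness matters only at zero, where the difference quotient is at most [C * |h|]; elsewhere the
    function is locally one of its two branches. *)
Lemma is_derive_flat p a t : 0 < a ->
  is_derive t (1 : R) (flat p a) (flat (dflat p a) a t).
Proof.
move=> a0; have [t0|t0|->] := ltgtP t 0.
- rewrite {2}/flat ltNge (ltW t0)/=.
  apply: (@near_eq_is_derive _ _ _ (cst 0)).
    by apply: filterS (lt_nbhsl t0) => s s0; rewrite /flat ltNge (ltW s0).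
- rewrite {2}/flat t0.
  apply: near_eq_is_derive (flat_pos p a t0).
  by apply: filterS (cvgr_gt t cvg_id 0 t0) => s s0; rewrite /flat s0.
- rewrite {2}/flat ltxx.
  have [C C0 HC] := flat_small p a0.
  have H : h^-1 *: ((flat p a \o shift 0) (h *: (1 : R)) - flat p a 0) @[h --> (0 : R)^'] --> (0 : R).
    apply/cvgr0Pnorm_le => e e0; near=> h.
    have h0 : h != 0 by near: h; exact: nbhs_dnbhs_neq.
    have h1 : `|h| <= 1 by near: h; exact: dnbhs0_le.
    have h2 : C * `|h| <= e.
      apply: (@le_trans _ _ ((C + 1) * `|h|)); first by rewrite ler_wpM2r// lerDl.
      rewrite mulrC -ler_pdivlMr ?ltr_wpDl//; near: h; apply: dnbhs0_le.
      by rewrite divr_gt0// ltr_wpDl.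
    have flat0 : flat p a 0 = 0 by rewrite /flat ltxx.
    rewrite /= addr0 [h *: 1]mulr1 flat0 subr0 [_ *: _]mulrC.
    have [hle0|h_gt0] := leP h 0.
      by rewrite /flat ltNge hle0 mul0r normr0 ltW.
    have h_le1 : h <= 1 by rewrite -(gtr0_norm h_gt0).
    rewrite normrM [X in _ * X]gtr0_norm ?invr_gt0// ler_pdivrMr//.
    apply: le_trans (HC h _) _; first by rewrite h_gt0.
    by rewrite expr2 mulrA ler_wpM2r// -{1}(gtr0_norm h_gt0)// ltW.
  apply: DeriveDef; last by apply/cvg_lim.
  by apply/cvg_ex; exists 0.
Unshelve. all: by end_near. Qed.

End flat.

Section smooth.
Context {R : realType} {n : nat}.
Implicit Types (f g : 'rV[R]_n -> R) (x v : 'rV[R]_n).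

(* A class of smooth functions, closed under partial derivatives, that is large
   enough to contain the test functions used; not all smooth functions. *)
Inductive smooth : ('rV[R]_n -> R) -> Prop :=
| smooth_cst c : smooth (fun=> c)
| smooth_coord i : smooth (fun x => x ord0 i)
| smooth_add f g : smooth f -> smooth g -> smooth (fun x => f x + g x)
| smooth_mul f g : smooth f -> smooth g -> smooth (fun x => f x * g x)
| smooth_flat p a f : 0 < a -> smooth f -> smooth (fun x => flat p a (f x)).

Lemma is_derive_coord x v i : is_derive x v (fun y : 'rV[R]_n => y ord0 i) (v ord0 i).
Proof.
have di : derivable (@id 'rV[R]_n) x v by exact: derivable_id.
have := derive_mx di; rewrite derive_id => E.
apply: DeriveDef; first by move/derivable_mxP : di; exact.
by move/matrixP/(_ ord0 i)/esym : E; rewrite [LHS]mxE.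
Qed.

Lemma is_derive_comp (F : R -> R) (F' : R) f x v :
  is_derive (f x) (1 : R) F F' -> differentiable f x ->
  is_derive x v (fun y => F (f y)) (F' * 'd f x v) /\
  differentiable (fun y => F (f y)) x.
Proof.
move=> dF df; have dF1 : differentiable F (f x) by exact/derivable1_diffP.
have dc : differentiable (F \o f) x by exact: differentiable_comp.
split => //; apply: DeriveDef; first exact: diff_derivable.
rewrite (deriveE _ dc) (diff_comp df dF1)/= (diff1E dF1) derive1E derive_val.
by rewrite mulrC.
Qed.

(** The derivative of each constructor is again built from the constructors; for [smooth_flat] this
    is what [dflat] provides. *)
Lemma smoothP f : smooth f -> forall x, differentiable f x /\
  forall v, smooth ('D_v f).
Proof.
elim=> [c|i|{}f g _ IHf _ IHg|{}f g sf IHf sg IHg|p a {}f a0 sf IHf] x.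
- split; first exact: differentiable_cst.
  move=> v; rewrite (_ : 'D_v _ = fun=> 0); first exact: smooth_cst.
  by apply/funext => y; rewrite derive_cst.
- split; first exact: differentiable_coord.
  move=> v; rewrite (_ : 'D_v _ = fun=> v ord0 i); first exact: smooth_cst.
  by apply/funext => y; rewrite (@derive_val _ _ _ _ _ _ _ (is_derive_coord y v i)).
- split; first by apply: differentiableD; [exact: (IHf x).1|exact: (IHg x).1].
  move=> v; rewrite (_ : 'D_v _ = fun y => 'D_v f y + 'D_v g y).
    by apply: smooth_add; [exact: (IHf x).2|exact: (IHg x).2].
  apply/funext => y; rewrite (@deriveD _ _ _ f g)//.
    exact: diff_derivable (IHf y).1.
  exact: diff_derivable (IHg y).1.
- split; first by apply: differentiableM; [exact: (IHf x).1|exact: (IHg x).1].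
  move=> v; rewrite (_ : 'D_v _ = fun y => f y * 'D_v g y + g y * 'D_v f y).
    by apply: smooth_add; apply: smooth_mul => //; [exact: (IHg x).2|exact: (IHf x).2].
  apply/funext => y; rewrite (@deriveM _ _ f g)//.
    exact: diff_derivable (IHf y).1.
  exact: diff_derivable (IHg y).1.
- split; first exact: (is_derive_comp 0 (is_derive_flat p (f x) a0) (IHf x).1).2.
  move=> v; rewrite (_ : 'D_v _ = fun y => flat (dflat p a) a (f y) * 'D_v f y).
    by apply: smooth_mul; [exact: smooth_flat|exact: (IHf x).2].
  apply/funext => y; rewrite (deriveE v (IHf y).1).
  have [dy _] := is_derive_comp v (is_derive_flat p (f y) a0) (IHf y).1.
  by rewrite (@derive_val _ _ _ _ _ _ _ dy).
Qed.

Lemma smooth_continuous f : smooth f -> continuous f.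
Proof. by move=> sf x; apply: differentiable_continuous; exact: (smoothP sf x).1. Qed.

Lemma smooth_Ck f k : smooth f -> Ck setT setT k f.
Proof.
elim: k f => [|k IH] f sf /=.
  by split => //; apply: continuous_subspaceT; exact: smooth_continuous.
split; first by apply: continuous_subspaceT; exact: smooth_continuous.
move=> v _; split; first by move=> x _; exact: diff_derivable (smoothP sf x).1.
by apply: IH; exact: (smoothP sf 0).2.
Qed.

Lemma smooth_sum (I : Type) (s : seq I) (F : I -> 'rV[R]_n -> R) :
  (forall i, smooth (F i)) -> smooth (fun x => \sum_(i <- s) F i x).
Proof.
move=> sF; elim: s => [|i s IH].
  rewrite (_ : (fun _ => _) = fun=> 0); first exact: smooth_cst.
  by apply/funext => x; rewrite big_nil.
rewrite (_ : (fun _ => _) = fun x => F i x + \sum_(j <- s) F j x).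
  exact: smooth_add.
by apply/funext => x; rewrite big_cons.
Qed.

Lemma smooth_prod (I : Type) (s : seq I) (F : I -> 'rV[R]_n -> R) :
  (forall i, smooth (F i)) -> smooth (fun x => \prod_(i <- s) F i x).
Proof.
move=> sF; elim: s => [|i s IH].
  rewrite (_ : (fun _ => _) = fun=> 1); first exact: smooth_cst.
  by apply/funext => x; rewrite big_nil.
rewrite (_ : (fun _ => _) = fun x => F i x * \prod_(j <- s) F j x).
  exact: smooth_mul.
by apply/funext => x; rewrite big_cons.
Qed.

End smooth.

(** * Lebesgue measure and the fundamental lemma of the calculus of variations *)

Section boxes.
Context {R : realType} {n : nat}.
Implicit Types (a b c d v : 'rV[R]_n) (U K : set 'rV[R]_n).
Local Notation mu := (lebesgue_rV R n).

Definition obox a b : set 'rV[R]_n := [set v | forall i, a ord0 i < v ord0 i < b ord0 i].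
Definition cbox a b : set 'rV[R]_n := [set v | forall i, a ord0 i <= v ord0 i <= b ord0 i].

Lemma obox_cbox a b : obox a b `<=` cbox a b.
Proof. by move=> v abv i; have /andP[/ltW -> /ltW ->] := abv i. Qed.

Lemma setI_obox a b c d : obox a b `&` obox c d =
  obox (\row_i Num.max (a ord0 i) (c ord0 i)) (\row_i Num.min (b ord0 i) (d ord0 i)).
Proof.
apply/seteqP; split => v /=.
  move=> [abv cdv] i; rewrite !mxE gt_max lt_min.
  by have /andP[-> ->] := abv i; have /andP[-> ->] := cdv i.
move=> H; split => i; have := H i; rewrite !mxE gt_max lt_min;
  by move=> /andP[/andP[? ?] /andP[? ?]]; apply/andP.
Qed.

Lemma oboxE a b : obox a b = [set v | forall i, `]a ord0 i, b ord0 i[%classic (v ord0 i)].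
Proof. by apply/seteqP; split => v /= H i; have := H i; rewrite /= in_itv. Qed.

Lemma cboxE a b : cbox a b = [set v | forall i, `[a ord0 i, b ord0 i]%classic (v ord0 i)].
Proof. by apply/seteqP; split => v /= H i; have := H i; rewrite /= in_itv. Qed.

Lemma measurable_prodbox (A : 'I_n -> set R) : (forall i, measurable (A i)) ->
  measurable [set v : 'rV[R]_n | forall i, A i (v ord0 i)].
Proof.
move=> mA.
have -> : [set v : 'rV[R]_n | forall i, A i (v ord0 i)] =
    \bigcap_(i in [set: 'I_n]) ((fun v : 'rV[R]_n => v ord0 i) @^-1` A i).
  by apply/seteqP; split => v /= vA i => [_|]; exact: vA.
apply: fin_bigcap_measurable => // i _; rewrite -[X in measurable X]setTI.
by apply: measurable_coor; first exact: measurableT.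
Qed.

Lemma measurable_obox a b : measurable (obox a b).
Proof. by rewrite oboxE; exact: (measurable_prodbox (A := fun i => `]a ord0 i, b ord0 i[%classic)). Qed.

Lemma measurable_cbox a b : measurable (cbox a b).
Proof. by rewrite cboxE; exact: (measurable_prodbox (A := fun i => `[a ord0 i, b ord0 i]%classic)). Qed.

Lemma cbox_compact a b : compact (cbox a b).
Proof.
rewrite cboxE; apply: (@rV_compact _ _ (fun i => `[a ord0 i, b ord0 i]%classic)).
by move=> i; exact: segment_compact.
Qed.

Lemma cbox_fin a b : (mu (cbox a b) < +oo)%E.
Proof.
rewrite cboxE (@lebesgue_rV_box _ _ (fun i => `[a ord0 i, b ord0 i]%classic))//.
rewrite ltey; apply/eqP => E.
have : (\prod_(i < n) lebesgue_measure (`[a ord0 i, b ord0 i]%classic : set R))%E \is a fin_num.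
  by apply: prode_fin_num => i _; rewrite lebesgue_measure_itv; case: ifP.
by rewrite E.
Qed.

Lemma obox_gt0 a b : (forall i, a ord0 i < b ord0 i) -> (0 < mu (obox a b))%E.
Proof.
move=> ab; rewrite oboxE (@lebesgue_rV_box _ _ (fun i => `]a ord0 i, b ord0 i[%classic))//.
apply: (@big_ind _ (fun x : \bar R => 0 < x)%E) => //.
  by move=> x y; exact: mule_gt0.
move=> i _; rewrite lebesgue_measure_itv/= lte_fin ab EFinN -EFinD lte_fin.
by rewrite subr_gt0.
Qed.

Lemma ball_rV v (e : R) (w : 'rV[R]_n) : 0 < e -> (forall i, `|v ord0 i - w ord0 i| < e) -> ball v e w.
Proof. by move=> e0 H; split => // i j; rewrite (ord1 i); exact: H. Qed.

Let rat_rV (k : nat) : 'rV[rat]_n * 'rV[rat]_n := odflt (0, 0) (unpickle k).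
Let lo k : 'rV[R]_n := map_mx ratr (rat_rV k).1.
Let hi k : 'rV[R]_n := map_mx ratr (rat_rV k).2.

(** Boxes with rational corners, enumerated through [pickle]. Closed boxes inside [U] later serve as
    compact sets for local integrability, and the strict inequalities between corners give positive
    measure. *)
Lemma open_bigcup_obox U : open U -> exists (P : set nat) (a b : nat -> 'rV[R]_n),
  [/\ U = \bigcup_(k in P) obox (a k) (b k),
      (forall k, P k -> cbox (a k) (b k) `<=` U) &
      (forall k, P k -> forall i, a k ord0 i < b k ord0 i)].
Proof.
move=> oU; exists [set k | cbox (lo k) (hi k) `<=` U /\ forall i, lo k ord0 i < hi k ord0 i], lo, hi.
split => [|k []//|k []//].
apply/seteqP; split => [x Ux|x [k /= [kU _] xk]]; last first.
  by apply: kU; exact: obox_cbox.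
have /nbhs_ballP[e /= e0 xe] := open_nbhs_nbhs (conj oU Ux).
have ex i : exists q : rat * rat, [/\ x ord0 i - e < ratr q.1, ratr q.1 < x ord0 i,
    x ord0 i < ratr q.2 & ratr q.2 < x ord0 i + e].
  have [q1] := @rat_in_itvoo R (x ord0 i - e) (x ord0 i) ltac:(by rewrite ltrBlDr ltrDl).
  have [q2] := @rat_in_itvoo R (x ord0 i) (x ord0 i + e) ltac:(by rewrite ltrDl).
  by rewrite !in_itv/= => /andP[h1 h2] /andP[h3 h4]; exists (q1, q2).
have [q Hq] := choice ex.
pose q' : 'rV[rat]_n * 'rV[rat]_n := (\row_i (q i).1, \row_i (q i).2).
have Eq : rat_rV (pickle q') = q' by rewrite /rat_rV pickleK.
have loE i : lo (pickle q') ord0 i = ratr (q i).1 by rewrite /lo Eq !mxE.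
have hiE i : hi (pickle q') ord0 i = ratr (q i).2 by rewrite /hi Eq !mxE.
exists (pickle q') => /=; last first.
  by move=> i; rewrite loE hiE; have [_ -> -> _] := Hq i.
split; last by move=> i; rewrite loE hiE; have [_ h1 h2 _] := Hq i; exact: lt_trans h1 h2.
move=> y Hy; apply: xe; apply: ball_rV => // i.
have := Hy i; rewrite loE hiE => /andP[h1 h2]; have [h3 _ _ h4] := Hq i.
by rewrite ltr_norml; apply/andP; split; lra.
Qed.

(** The sigma-algebra is generated by the coordinates, so open sets enter it as countable unions of
    boxes. *)
Lemma measurable_open U : open U -> measurable U.
Proof.
move=> /open_bigcup_obox[P [a [b [-> _ _]]]].
by apply: bigcup_measurable => k _; exact: measurable_obox.
Qed.

Lemma open_gt0 U : open U -> U !=set0 -> (0 < mu U)%E.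
Proof.
move=> oU; have [P [a [b [UE _ ab]]]] := open_bigcup_obox oU.
move=> [x]; rewrite {1}UE => -[k Pk _].
apply: lt_le_trans (obox_gt0 (ab k Pk)) _.
apply: le_measure; rewrite ?inE; [exact: measurable_obox|exact: measurable_open|].
by move=> y yk; rewrite UE; exists k.
Qed.

Lemma measurable_compact K : compact K -> measurable K.
Proof.
move=> /(compact_closed (@norm_hausdorff _ _)) cK.
rewrite -(setCK K); apply: measurableC; apply: measurable_open.
exact: closed_openC.
Qed.

Lemma compact_cbox K : compact K -> exists2 M : R, 0 < M &
  K `<=` cbox (const_mx (- M)) (const_mx M).
Proof.
move=> /compact_bounded[M [_ KM]]; exists (`|M| + 1); first by rewrite ltr_wpDl.
have MM : M < `|M| + 1 by rewrite (le_lt_trans (ler_norm _))// ltrDl.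
move=> v Kv i; rewrite !mxE -ler_norml; apply: le_trans (coord_le v i) _.
exact: KM MM v Kv.
Qed.

Lemma compact_fin K : compact K -> (mu K < +oo)%E.
Proof.
move=> cK; have [M _ KM] := compact_cbox cK.
apply: le_lt_trans (cbox_fin (const_mx (- M)) (const_mx M)).
by apply: le_measure => //; rewrite inE; [exact: measurable_compact|exact: measurable_cbox].
Qed.

Lemma continuous_measurable_rV U (f : 'rV[R]_n -> R) : open U ->
  (forall x, U x -> {for x, continuous f}) -> measurable_fun U f.
Proof.
move=> oU cf; apply: (measurability _ (RGenOInfty.measurableE R)).
move=> /= _ [_ [a ->]] <-; apply: measurable_open.
rewrite openE => x [Ux /= fx]; rewrite /interior; apply: filterI.
  exact: open_nbhs_nbhs.
apply: (cf x Ux); apply: open_nbhs_nbhs; split => //; exact: interval_open.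
Qed.

End boxes.

(** * Vanishing integrals of compactly supported partial derivatives *)

Section integral_partial.
Context {R : realType}.

Lemma integral_derive1_eq0 (F f : R -> R) (M : R) : 0 < M ->
  (forall x, is_derive x (1 : R) F (f x)) -> continuous f ->
  (forall x, M < `|x| -> F x = 0) -> (forall x, M < `|x| -> f x = 0) ->
  (\int[lebesgue_measure]_x (f x)%:E = 0)%E.
Proof.
move=> M0 dF cf F0 f0.
have M1 : M < M + 1 by rewrite ltrDl.
have Mp : 0 < M + 1 by rewrite addr_gt0.
have NM : - (M + 1) < M + 1 by rewrite gtrN.
(* [F] is known to vanish only where [M < |x|], so the endpoints are moved beyond [M]. *)
pose D : set R := `[(- (M + 1)), (M + 1)]%classic.
transitivity (\int[lebesgue_measure]_(x in D) (f x)%:E)%E.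
  rewrite [RHS]integral_mkcond; apply: eq_integral => x _.
  rewrite patchE; case: ifPn => // /negP xM; rewrite f0//.
  rewrite ltNge; apply/negP => xM'; apply: xM; rewrite inE /D/= in_itv/= -ler_norml.
  by rewrite (le_trans xM')// ltW.
rewrite (@continuous_FTC2 _ f F)//.
- by rewrite !F0 ?normrN ?gtr0_norm// subee.
- exact: continuous_subspaceT.
- have cF : continuous F.
    move=> x; apply: differentiable_continuous; apply/derivable1_diffP.
    by have [] := dF x.
  split; first by move=> x _; have [] := dF x.
  - exact: cvg_at_right_filter (cF _).
  - exact: cvg_at_left_filter (cF _).
- by move=> x _; rewrite derive1E; have [] := dF x.
Qed.

Lemma row_cons0 n (x : R) (w : 'rV[R]_n) : row_cons (x, w) ord0 ord0 = x.
Proof. by rewrite mxE unlift_none. Qed.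

Lemma row_consS n (x : R) (w : 'rV[R]_n) i :
  row_cons (x, w) ord0 (lift ord0 i) = w ord0 i.
Proof. by rewrite mxE liftK. Qed.

Lemma row_consP n (v : 'rV[R]_n.+1) (x : R) (w : 'rV[R]_n) :
  v ord0 ord0 = x -> (forall i, v ord0 (lift ord0 i) = w ord0 i) ->
  v = row_cons (x, w).
Proof.
move=> v0 vS; apply/rowP => i.
by case: (unliftP ord0 i) => [j|] ->; rewrite ?row_cons0 ?row_consS.
Qed.

Lemma continuous_row_consr n (x : R) : continuous (fun w : 'rV[R]_n => row_cons (x, w)).
Proof.
move=> w; apply: continuous_mx => i j; rewrite (ord1 i).
case: (unliftP ord0 j) => [k|] ->.
- have -> : (fun y : 'rV[R]_n => row_cons (x, y) ord0 (lift ord0 k)) = (fun y => y ord0 k).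
    by apply/funext => y; rewrite row_consS.
  exact: coord_continuous.
- have -> : (fun y : 'rV[R]_n => row_cons (x, y) ord0 ord0) = cst x.
    by apply/funext => y; rewrite row_cons0.
  exact: cst_continuous.
Qed.

Lemma continuous_row_consl n (w : 'rV[R]_n) : continuous (fun x : R => row_cons (x, w)).
Proof.
move=> x; apply: continuous_mx => i j; rewrite (ord1 i).
case: (unliftP ord0 j) => [k|] ->.
- have -> : (fun y : R => row_cons (y, w) ord0 (lift ord0 k)) = cst (w ord0 k).
    by apply/funext => y; rewrite row_consS.
  exact: cst_continuous.
- have -> : (fun y : R => row_cons (y, w) ord0 ord0) = id.
    by apply/funext => y; rewrite row_cons0.
  exact: cvg_id.
Qed.

Lemma integrable_continuous_box n (g : 'rV[R]_n -> R) (M : R) :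
  continuous g ->
  (forall x, ~ cbox (const_mx (- M)) (const_mx M) x -> g x = 0) ->
  (lebesgue_rV R n).-integrable setT (EFin \o g).
Proof.
move=> cg g0; set K := cbox _ _ in g0.
have mg : measurable_fun setT g.
  exact: (continuous_measurable_rV openT (fun x _ => cg x)).
have -> : EFin \o g = (EFin \o g) \_ K.
  apply/funext => x; rewrite patchE; case: ifPn => //= /negP xK.
  by rewrite g0// => Kx; apply: xK; rewrite inE.
apply/(integrable_mkcond _ (measurable_cbox _ _)).
apply: measurable_bounded_integrable.
- exact: measurable_cbox.
- exact: cbox_fin.
- exact: measurable_funTS.
- have /compact_bounded : compact (g @` K).
    by apply: continuous_compact; [exact: continuous_subspaceT|exact: cbox_compact].
  move=> [B [Br HB]]; exists B; split => // B' BB' x Kx.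
  by apply: HB => //; exists x.
Qed.

(** Induction on the dimension with Fubini. The regularity asked of [w] is what the product rule
    yields directly for products extended by zero. *)
Lemma integral_partial_eq0 n (i : 'I_n) (w : 'rV[R]_n -> R) (M : R) : 0 < M ->
  (forall x, derivable w x (delta_mx ord0 i)) ->
  continuous (partial i w) ->
  (forall x, ~ cbox (const_mx (- M)) (const_mx M) x -> w x = 0) ->
  (forall x, ~ cbox (const_mx (- M)) (const_mx M) x -> partial i w x = 0) ->
  (\int[lebesgue_rV R n]_x (partial i w x)%:E = 0)%E.
Proof.
move=> M0; elim: n i w => [[]//|n IH] i w dw cw w0 dw0.
have mp : measurable_fun setT (partial i w).
  exact: (continuous_measurable_rV openT (fun x _ => cw x)).
have mpE : measurable_fun setT (EFin \o partial i w) by exact/measurable_EFinP.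
have ip := integrable_continuous_box cw dw0.
have mrc : measurable_fun setT (@row_cons R n) := @measurable_row_cons R n.
have ipc : ((lebesgue_measure : set (measurableTypeR R) -> \bar R) \x lebesgue_rV R n)%E.-integrable
    setT ((EFin \o partial i w) \o @row_cons R n).
  apply/integrableP; split; first exact: measurableT_comp.
  move/integrableP : ip => [_]; apply: le_lt_trans.
  rewrite (ge0_integral_pushforward mrc (lebesgue_measure \x lebesgue_rV R n)%E
    (D := setT) (f := fun x => `|(EFin \o partial i w) x|%E))//.
  exact: measurableT_comp.
have boxS x v : ~ cbox (const_mx (- M)) (const_mx M) v ->
    ~ cbox (const_mx (- M)) (const_mx M) (row_cons (x, v)).
  move=> H H'; apply: H => j; have := H' (lift ord0 j).
  by rewrite row_consS !mxE.
have box0 x v : M < `|x| -> ~ cbox (const_mx (- M)) (const_mx M) (row_cons (x, v)).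
  by move=> Mx H; have := H ord0; rewrite row_cons0 !mxE -ler_norml leNgt Mx.
transitivity (\int[(lebesgue_measure \x lebesgue_rV R n)%E]_p (partial i w (row_cons p))%:E)%E.
  exact: (integral_pushforward mrc (D := setT) mpE ipc measurableT).
case: (unliftP ord0 i) => [j|] ij.
(* Not the first coordinate: the first one is integrated last, and the induction hypothesis
   annihilates each slice. *)
- rewrite -(integral12_prod_meas1 ipc) /=; apply: integral0_eq => x _.
  pose wx v := w (row_cons (x, v)).
  have E v : (fun h : R => h^-1 *: ((wx \o shift v) (h *: delta_mx ord0 j) - wx v)) =
      (fun h : R => h^-1 *: ((w \o shift (row_cons (x, v))) (h *: delta_mx ord0 i) - w (row_cons (x, v)))).
    apply/funext => h /=; rewrite /wx; congr (_ *: (w _ - _)).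
    apply/esym/row_consP => [|k]; rewrite !mxE ij.
      by rewrite unlift_none/= mulr0 add0r.
    by rewrite liftK (inj_eq lift_inj).
  have Ep v : partial j wx v = partial i w (row_cons (x, v)).
    by rewrite /partial /derive E.
  transitivity (\int[lebesgue_rV R n]_v (partial j wx v)%:E)%E.
    by apply: eq_integral => v _; rewrite Ep.
  apply: IH.
  + by move=> v; have := dw (row_cons (x, v)); rewrite /derivable E.
  + have -> : partial j wx = partial i w \o (fun v => row_cons (x, v)).
      by apply/funext => v; rewrite Ep.
    by move=> v; apply: continuous_comp; [exact: continuous_row_consr|exact: cw].
  + by move=> v Hv; exact: w0 (boxS _ _ _ Hv).
  + by move=> v Hv; rewrite Ep; exact: dw0 (boxS _ _ _ Hv).
(* The first coordinate: it is integrated first, by the fundamental theorem of calculus on each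
   line. *)
- rewrite -(integral21_prod_meas1 ipc) /=; apply: integral0_eq => v _.
  pose F x := w (row_cons (x, v)).
  apply: (@integral_derive1_eq0 F (fun x => partial i w (row_cons (x, v))) M) => //.
  + move=> x.
    have E : (fun h : R => h^-1 *: ((F \o shift x) (h *: (1 : R)) - F x)) =
        (fun h : R => h^-1 *: ((w \o shift (row_cons (x, v))) (h *: delta_mx ord0 i) - w (row_cons (x, v)))).
      apply/funext => h /=; rewrite /F; congr (_ *: (w _ - _)).
      apply/esym/row_consP => [|k]; rewrite !mxE ij.
        by rewrite unlift_none.
      by rewrite liftK/= mulr0 add0r.
    apply: DeriveDef; first by rewrite /derivable E; exact: dw.
    by rewrite /partial /derive E.
  + by move=> x; apply: continuous_comp; [exact: continuous_row_consl|exact: cw].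
  + by move=> x Mx; exact: w0 (box0 _ _ _ Mx).
  + by move=> x Mx; exact: dw0 (box0 _ _ _ Mx).
Qed.

End integral_partial.

(** * From vanishing integrals over boxes to vanishing almost everywhere *)

Section fundamental_lemma.
Context {R : realType} {n : nat}.
Implicit Types (a b c d v : 'rV[R]_n) (U K : set 'rV[R]_n).
Local Notation mu := (lebesgue_rV R n).

Definition oboxes : set (set 'rV[R]_n) := [set B | exists a b, B = obox a b].

Lemma setI_closed_oboxes : setI_closed oboxes.
Proof.
move=> _ _ [a [b ->]] [c [d ->]]; rewrite setI_obox.
by eexists; eexists.
Qed.

Lemma measurable_oboxesE : @measurable _ 'rV[R]_n = <<s oboxes >>.
Proof.
apply/seteqP; split; last first.
  apply: smallest_sub; first exact: sigma_algebra_measurable.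
  by move=> _ [a [b ->]]; exact: measurable_obox.
pose T := g_sigma_algebraType oboxes.
have mid : measurable_fun [set: T] (fun x : T => x : 'rV[R]_n).
  apply: measurable_fun_coorP => i.
  apply: (measurability _ (RGenOInfty.measurableE R)).
  move=> /= _ [_ [r ->]] <-; rewrite setTI.
  (* A coordinate half-space is a countable union of boxes whose other sides grow with [k]. *)
  rewrite (_ : _ @^-1` _ = \bigcup_k obox
      (\row_j (if j == i then r else - k%:R)) (const_mx k%:R)).
    by apply: bigcup_measurable => k _; apply: sub_sigma_algebra; eexists; eexists.
  apply/seteqP; split => [x|x [k _ /(_ i)]]; rewrite /= ?in_itv/= ?andbT; last first.
    by rewrite !mxE eqxx => /andP[].
  move=> rx; have [k kx] : exists k : nat, `|x| < k%:R.
    by exists (Num.truncn `|x|).+1; exact: truncnS_gt.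
  exists k => // j; rewrite !mxE.
  have : `|x ord0 j| < k%:R := le_lt_trans (coord_le x j) kx.
  by rewrite ltr_norml => /andP[h1 h2]; rewrite h2 andbT; case: eqP => [->|].
by move=> A mA; have := mid measurableT A mA; rewrite setTI.
Qed.

(** The sets [S] with zero integral over [S] within [B] form a Dynkin system containing the open
    boxes, which are stable under intersection and generate. Working inside one box keeps [g]
    integrable and lets [B] stand for the whole space. *)
Lemma obox_integral_eq0 a b (g : 'rV[R]_n -> \bar R) :
  mu.-integrable (obox a b) g ->
  (forall c d, (\int[mu]_(x in obox c d `&` obox a b) g x = 0)%E) ->
  ae_eq mu (obox a b) g (cst 0%E).
Proof.
move=> ig H; set B := obox a b in ig H *.
have mB : measurable B := measurable_obox a b.
have H' S : measurable S -> (\int[mu]_(x in S `&` B) g x = 0)%E.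
  rewrite measurable_oboxesE; move: S.
  apply: (dynkin_induction measurable_oboxesE setI_closed_oboxes).
  - by rewrite setTI -[B]setIid; exact: H.
  - by move=> _ [c [d ->]]; exact: H.
  - move=> S mS S0.
    have : (\int[mu]_(x in (S `&` B) `|` (~` S `&` B)) g x = 0)%E.
      by rewrite -setIUl setUv setTI -[B]setIid; exact: H.
    rewrite integral_setU//=.
    + by rewrite S0 add0e.
    + exact: measurableI.
    + by apply: measurableI => //; exact: measurableC.
    + rewrite -setIUl setUv setTI; exact: measurable_int ig.
    + apply/disj_setPS => x [[Sx _] [nSx _]]; exact: nSx.
  - move=> F mF tF F0; rewrite setI_bigcupl integral_bigcup//.
    + by apply: eseries0 => k _ _; exact: F0.
    + by apply: trivIset_setIr.
    + by move=> k; exact: measurableI.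
    + apply: integrableS ig => //; first by apply: bigcup_measurable => k _; exact: measurableI.
      by move=> x [k _ []].
apply: integral_ae_eq => // E EB mE; rewrite [RHS]integral0//.
by rewrite -(setIidl EB); exact: H'.
Qed.

(** As [1 / (m + 1)] tends to zero each factor increases to the indicator of a half-line: these are
    smooth functions, bounded by 1 and zero off the open box, that converge pointwise to its
    indicator. *)
Definition box_bump (c d : 'rV[R]_n) (m : nat) (x : 'rV[R]_n) : R :=
  \prod_(i < n) (flat 1 m.+1%:R^-1 (x ord0 i - c ord0 i) *
                 flat 1 m.+1%:R^-1 (d ord0 i - x ord0 i)).

Lemma smooth_coordB i (r : R) : smooth (fun x : 'rV[R]_n => x ord0 i - r).
Proof. by apply: smooth_add; [exact: smooth_coord|exact: smooth_cst]. Qed.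

Lemma smooth_Bcoord i (r : R) : smooth (fun x : 'rV[R]_n => r - x ord0 i).
Proof.
rewrite (_ : (fun _ => _) = fun x : 'rV[R]_n => r + (-1) * x ord0 i).
  apply: smooth_add; first exact: smooth_cst.
  by apply: smooth_mul; [exact: smooth_cst|exact: smooth_coord].
by apply/funext => x; rewrite mulN1r.
Qed.

Lemma smooth_box_bump c d m : smooth (box_bump c d m).
Proof.
have m0 : 0 < m.+1%:R^-1 :> R by rewrite invr_gt0 ltr0n.
apply: smooth_prod => i; apply: smooth_mul; apply: smooth_flat => //.
  exact: smooth_coordB.
exact: smooth_Bcoord.
Qed.

Lemma flat1_itv (e t : R) : 0 < e -> 0 <= flat 1 e t <= 1.
Proof.
move=> e0; rewrite /flat; case: ifPn => [t0|_]; last by rewrite lexx ler01.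
rewrite hornerC mul1r expR_ge0/= -expR0 ler_expR mulNr oppr_le0.
by rewrite divr_ge0// ltW.
Qed.

Lemma cvg_flat1 (t : R) : flat 1 m.+1%:R^-1 t @[m --> \oo] --> ((0 < t)%R%:R : R).
Proof.
rewrite /flat; case: ltP => t0 /=; last exact: cvg_cst.
rewrite (_ : (fun _ => _) = fun m => expR ((- t^-1) * m.+1%:R^-1)); last first.
  by apply/funext => m; rewrite hornerC mul1r mulrC mulrN mulNr.
rewrite -[X in _ --> X]expR0; apply: continuous_cvg; first exact: continuous_expR.
rewrite -[X in _ --> X](mulr0 (- t^-1)); apply: cvgM; first exact: cvg_cst.
exact: cvg_harmonic.
Qed.

Lemma box_bump_out c d m x : ~ obox c d x -> box_bump c d m x = 0.
Proof.
move=> /existsNP[i /negP]; rewrite negb_and -!leNgt => H.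
rewrite /box_bump (bigD1 i)//=; case/orP : H => H.
  by rewrite /flat [0 < x ord0 i - _]ltNge subr_le0 H !mul0r.
by rewrite /flat [0 < d ord0 i - _]ltNge subr_le0 H mulr0 mul0r.
Qed.

Lemma box_bump_itv c d m x : `|box_bump c d m x| <= 1.
Proof.
have m0 : 0 < m.+1%:R^-1 :> R by rewrite invr_gt0 ltr0n.
rewrite normr_prod; apply: prodr_ile1 => i _; rewrite normr_ge0/= normrM.
have [/andP[h1 h2] /andP[h3 h4]] := (flat1_itv (x ord0 i - c ord0 i) m0,
  flat1_itv (d ord0 i - x ord0 i) m0).
by rewrite !ger0_norm// mulr_ile1.
Qed.

Lemma cvg_box_bump c d x :
  box_bump c d m x @[m --> \oo] --> ((x \in obox c d)%:R : R).
Proof.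
have [xcd|xcd] := boolP (x \in obox c d); last first.
  rewrite (_ : (fun _ => _) = fun=> 0); first exact: cvg_cst.
  by apply/funext => m; apply: box_bump_out => H; move/negP : xcd; apply; rewrite inE.
rewrite [X in _ --> X](_ : _ = \prod_(i < n) (1 * 1 : R)); last by rewrite mulr1 big1.
apply: cvg_big.
  by move=> /= p; apply: cvgM; [exact: cvg_fst|exact: cvg_snd].
move=> i _; move: xcd; rewrite inE => /(_ i)/andP[h1 h2]; apply: cvgM.
  by have := @cvg_flat1 (x ord0 i - c ord0 i); rewrite subr_gt0 h1.
by have := @cvg_flat1 (d ord0 i - x ord0 i); rewrite subr_gt0 h2.
Qed.

Lemma test_box_bump U c d m K : compact K -> K `<=` U -> obox c d `<=` K ->
  test_function U (box_bump c d m).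
Proof.
move=> cK KU cdK; split; first by move=> k; apply: smooth_Ck; exact: smooth_box_bump.
by exists K; split => // x Kx; apply: box_bump_out => /cdK.
Qed.

(** Testing with [box_bump] and dominated convergence give zero integrals over boxes within each box
    of a countable cover of [U], hence [g = 0] almost everywhere in each of these. *)
Lemma fundamental_lemma U (g : 'rV[R]_n -> R) : open U ->
  locally_integrable_on U g ->
  (forall phi, test_function U phi -> \int[mu]_(x in U) (g x * phi x) = 0) ->
  {ae mu, forall x, U x -> g x = 0}.
Proof.
move=> oU [mg lg] g0.
have mU := measurable_open oU.
have [P [a [b [UE abU _]]]] := open_bigcup_obox oU.
have box0 k : P k -> ae_eq mu (obox (a k) (b k)) (EFin \o g) (cst 0%E).
  move=> Pk; set K := cbox (a k) (b k).
  have KU : K `<=` U := abU k Pk.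
  have cK : compact K by exact: cbox_compact.
  have mK : measurable K by exact: measurable_cbox.
  have igK : mu.-integrable K (EFin \o g) by exact: lg.
  apply: obox_integral_eq0.
    by apply: integrableS igK => //; [exact: measurable_obox|exact: obox_cbox].
  move=> c d; rewrite setI_obox; set c' := (\row__ _); set d' := (\row__ _).
  have QK : obox c' d' `<=` K.
    by rewrite /c' /d' -setI_obox => x [_ /obox_cbox].
  pose f m x := (g x * box_bump c' d' m x)%:E.
  have mgK : measurable_fun K g by apply: measurable_funS mg.
  have mbump m : measurable_fun K (box_bump c' d' m).
    apply: measurable_funTS; apply: (continuous_measurable_rV openT) => x _.
    exact: smooth_continuous (smooth_box_bump c' d' m) x.
  have mf m : measurable_fun K (f m).
    by apply/measurable_EFinP; exact: measurable_funM.
  have fle m x : (`|f m x| <= `|(g x)%:E|)%E.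
    rewrite /f/= lee_fin normrM ler_piMr//; exact: box_bump_itv.
  have fi m : mu.-integrable K (f m).
    by apply: le_integrable igK.
  have f0 m : (\int[mu]_(x in K) f m x = 0)%E.
    have := g0 _ (test_box_bump m cK KU QK).
    rewrite /Rintegral.
    have -> : (\int[mu]_(x in U) (g x * box_bump c' d' m x)%:E = \int[mu]_(x in K) f m x)%E.
      rewrite [LHS]integral_mkcond [RHS]integral_mkcond; apply: eq_integral => x _.
      rewrite !patchE; case: ifPn => xU; case: ifPn => xK //.
        rewrite box_bump_out ?mulr0// => /QK Kx.
        by move/negP : xK; apply; rewrite inE.
      move/negP : xU; case; move: xK; rewrite !inE; exact: KU.
    (* [Rintegral] is a [fine] part, which also maps infinite values to zero; integrability excludes
       them. *)
    move=> F0; rewrite -[LHS]fineK ?F0//; exact: integrable_fin_num (fi m).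
  pose h x := (g x * (x \in obox c' d')%:R)%:E.
  have mQ := measurable_obox c' d'.
  have hE : h = (EFin \o g) \_ (obox c' d').
    apply/funext => x; rewrite /h patchE; case: ifPn => _; first by rewrite mulr1.
    by rewrite mulr0.
  have mh : measurable_fun K h.
    rewrite hE; apply/(measurable_restrict _ mQ mK); apply/measurable_EFinP.
    by apply: measurable_funS mgK => //; exact: subIsetl.
  have fh x : f m x @[m --> \oo] --> h x.
    apply: cvg_EFin; first exact: nearW.
    by apply: cvgM; [exact: cvg_cst|exact: cvg_box_bump].
  have [_ _] := dominated_convergence mK mf mh (aeW _ (fun x _ => fh x))
    (integrable_abse igK) (aeW _ (fun x m _ => fle m x)).
  rewrite (_ : [sequence _]_n = cst 0%E); last by apply/funext.
  move=> /(cvg_unique (@ereal_hausdorff R) (cvg_cst 0%E)) fcv.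
  move: fcv; rewrite hE -integral_mkcondr (setIidr QK) => <- //.
have H : {ae mu, forall x, forall k, P k -> obox (a k) (b k) x -> g x = 0}.
  apply/ae_foralln => k; have [Pk|nPk] := pselect (P k); last exact: aeW.
  by have := box0 k Pk; apply: filterS => x Hx _ /Hx[].
apply: filterS H => x Hx; rewrite {1}UE => -[k Pk xk]; exact: Hx xk.
Qed.

End fundamental_lemma.

(** * Weak derivatives of classically differentiable functions *)

Section weak_partial.
Context {R : realType} {n : nat}.
Implicit Types (U K : set 'rV[R]_n) (f g u phi : 'rV[R]_n -> R) (i j : 'I_n).
Local Notation mu := (lebesgue_rV R n).

Lemma test_function_partial U phi i : test_function U phi ->
  [/\ continuous phi, continuous (partial i phi),
      forall x, derivable phi x (delta_mx ord0 i) &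
      exists K, [/\ compact K, K `<=` U, (forall x, ~ K x -> phi x = 0) &
        forall x, ~ K x -> partial i phi x = 0]].
Proof.
move=> [Cphi [K [cK KU phi0]]]; split.
- by move=> x; exact: (Ck_continuous openT (Cphi 0%N)).
- by move=> x; exact: (Ck_continuous openT (Ck_derive _ (Cphi 1%N))).
- by move=> x; exact: (Ck_derivable (Cphi 1%N)).
- exists K; split => // x nKx.
  have oKC : open (~` K) by apply/closed_openC; exact: compact_closed (@norm_hausdorff _ _) cK.
  rewrite /partial -(@near_eq_derive _ _ _ (cst 0)) ?derive_cst//.
  by apply: filterS (open_nbhs_nbhs (conj oKC nKx)) => y /phi0 ->.
Qed.

(* Off the compact [K] the product is locally zero, so extending it by zero
   outside [U] keeps it regular. *)
Lemma near_patch U K f phi x : open U -> compact K -> K `<=` U ->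
  (forall x, ~ K x -> phi x = 0) ->
  (U x /\ \forall y \near x, (f \* phi) y = ((f \* phi) \_ U) y) \/
  (~ K x /\ \forall y \near x, ~ K y /\ cst 0 y = ((f \* phi) \_ U) y).
Proof.
move=> oU cK KU phi0; have [Ux|nUx] := pselect (U x).
  left; split => //; apply: filterS (open_nbhs_nbhs (conj oU Ux)) => y Uy.
  by rewrite patchE mem_set.
right; have nKx : ~ K x by move=> /KU.
split => //.
have oKC : open (~` K) by apply/closed_openC; exact: compact_closed (@norm_hausdorff _ _) cK.
apply: filterS (open_nbhs_nbhs (conj oKC nKx)) => y nKy; split => //.
by rewrite patchE /= phi0// mulr0; case: ifP.
Qed.

Lemma continuous_patch U K f phi : open U -> compact K -> K `<=` U ->
  (forall x, U x -> {for x, continuous f}) -> continuous phi ->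
  (forall x, ~ K x -> phi x = 0) -> continuous ((f \* phi) \_ U).
Proof.
move=> oU cK KU cf cphi phi0 x.
have [[Ux H]|[nKx H]] := near_patch f x oU cK KU phi0.
  apply: cvg_trans (near_eq_cvg H) _; rewrite -(nbhs_singleton H).
  by apply: cvgM; [exact: cf|exact: cphi].
have H' : \forall y \near x, cst 0 y = ((f \* phi) \_ U) y by apply: filterS H => y [].
apply: cvg_trans (near_eq_cvg H') _; rewrite -(nbhs_singleton H').
exact: cvg_cst.
Qed.

Lemma integrable_locally_integrableM U K g phi : open U ->
  locally_integrable_on U g -> compact K -> K `<=` U -> continuous phi ->
  (forall x, ~ K x -> phi x = 0) -> mu.-integrable U (EFin \o (g \* phi)).
Proof.
move=> oU [mg lg] cK KU cphi phi0; have mK := measurable_compact cK.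
have mU := measurable_open oU.
have -> : EFin \o (g \* phi) = (EFin \o (g \* phi)) \_ K.
  apply/funext => x; rewrite patchE; case: ifPn => // /negP xK.
  by rewrite /= phi0 ?mulr0// => Kx; apply: xK; rewrite inE.
apply/(integrable_restrict _ mK); rewrite ?(setIidr KU) ?(setIidl KU).
  exact: mU.
have [B HB] : exists B : R, forall x, K x -> `|phi x| <= B.
  have /compact_bounded[B [_ HB]] : compact (phi @` K).
    by apply: continuous_compact => //; exact: continuous_subspaceT.
  by exists (B + 1) => x Kx; apply: (HB (B + 1)); [rewrite ltrDl|exists x].
have mgK : measurable_fun K g by apply: measurable_funS mg.
have mphi : measurable_fun K phi.
  by apply: measurable_funTS; exact: (continuous_measurable_rV openT (fun x _ => cphi x)).
have iB := integrableZl mK B (lg K cK KU).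
apply: le_integrable iB => //.
  by apply/measurable_EFinP; exact: measurable_funM.
move=> x Kx; rewrite /= lee_fin !normrM mulrC ler_wpM2r//.
by rewrite (le_trans (HB x Kx))// ler_norm.
Qed.

Lemma locally_integrable_continuous U f : open U ->
  (forall x, U x -> {for x, continuous f}) -> locally_integrable_on U f.
Proof.
move=> oU cf; have mf := continuous_measurable_rV oU cf; split => // K cK KU.
have mK := measurable_compact cK.
apply: measurable_bounded_integrable => //; first exact: compact_fin.
  by apply: measurable_funS mf => //; exact: measurable_open.
have /compact_bounded[B [Br HB]] : compact (f @` K).
  apply: continuous_compact => //; apply: (@continuous_subspaceW _ _ _ U) => //.
  rewrite continuous_open_subspace// => x; rewrite inE; exact: cf.
by exists B; split => // B' BB' x Kx; apply: HB => //; exists x.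
Qed.

(** Integration by parts: [f phi] extended by zero has a continuous compactly supported partial
    derivative, whose integral vanishes. The extension is needed since [f] is regular only on
    [U]. *)
Lemma classical_weak_partial U i f : open U -> Ck setT U 1 f ->
  is_weak_partial U i f (partial i f).
Proof.
move=> oU Cf.
have cf x : U x -> {for x, continuous f} by move=> Ux; exact: Ck_continuous oU Cf Ux.
have cpf x : U x -> {for x, continuous (partial i f)}.
  by move=> Ux; exact: Ck_continuous oU (Ck_derive _ Cf) Ux.
have lf := locally_integrable_continuous oU cf.
have lpf := locally_integrable_continuous oU cpf.
split => // phi tphi.
have [cphi cpphi dphi [K [cK KU phi0 pphi0]]] := test_function_partial i tphi.
have mU := measurable_open oU.
pose w := (f \* phi) \_ U.
have Ux_dw x : U x -> (\forall y \near x, (f \* phi) y = w y) ->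
    is_derive x (delta_mx ord0 i) w (f x * partial i phi x + partial i f x * phi x).
  move=> Ux H; apply: (near_eq_is_derive H).
  have df : is_derive x (delta_mx ord0 i) f (partial i f x).
    by apply: DeriveDef => //; exact: (Ck_derivable Cf).
  have dp : is_derive x (delta_mx ord0 i) phi (partial i phi x) by exact: DeriveDef.
  apply: is_derive_eq (is_deriveM df dp) _.
  by congr (_ + _); rewrite [LHS]mulrC.
have nK_dw x : (\forall y \near x, ~ K y /\ cst 0 y = w y) ->
    is_derive x (delta_mx ord0 i) w 0.
  move=> H; apply: (@near_eq_is_derive _ _ _ (cst 0)).
  by apply: filterS H => y [].
have pw x : partial i w x = ((f \* partial i phi) \_ U) x + ((partial i f \* phi) \_ U) x.
  rewrite !patchE.
  have [[Ux H]|[nKx H]] := near_patch f x oU cK KU phi0.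
    by rewrite mem_set// /partial (@derive_val _ _ _ _ _ _ _ (Ux_dw x Ux H)).
  rewrite /partial (@derive_val _ _ _ _ _ _ _ (nK_dw x H)) /= phi0// mulr0 -/(partial i phi x).
  by rewrite pphi0// mulr0; case: ifP; rewrite addr0.
have c1 := continuous_patch oU cK KU cf cpphi pphi0.
have c2 := continuous_patch oU cK KU cpf cphi phi0.
have [M M0 KM] := compact_cbox cK.
have : (\int[mu]_x (partial i w x)%:E = 0)%E.
  apply: (integral_partial_eq0 M0).
  - move=> x; have [[Ux H]|[nKx H]] := near_patch f x oU cK KU phi0.
      by have [] := Ux_dw x Ux H.
    by have [] := nK_dw x H.
  - have -> : partial i w = (fun x => ((f \* partial i phi) \_ U) x + ((partial i f \* phi) \_ U) x).
      by apply/funext.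
    by move=> x; exact: (continuousD (c1 x) (c2 x)).
  - move=> x Hx; rewrite /w patchE /= phi0 ?mulr0; first by case: ifP.
    by move=> /KM.
  - move=> x Hx; have nKx : ~ K x by move=> /KM.
    by rewrite pw !patchE /= pphi0// phi0// !mulr0; case: ifP; rewrite addr0.
have i1 := integrable_locally_integrableM oU lf cK KU cpphi pphi0.
have i2 := integrable_locally_integrableM oU lpf cK KU cphi phi0.
have -> : (\int[mu]_x (partial i w x)%:E =
    \int[mu]_(x in U) (f x * partial i phi x + partial i f x * phi x)%:E)%E.
  rewrite [RHS]integral_mkcond; apply: eq_integral => x _.
  by rewrite pw !patchE; case: ifP => _ //; rewrite addr0.
move=> H; apply/eqP; rewrite -addr_eq0 -(RintegralD mU i1 i2); apply/eqP.
by rewrite /Rintegral H.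
Qed.

Lemma ae_eq_Rintegral U f g : measurable U -> measurable_fun U f -> measurable_fun U g ->
  {ae mu, forall x, U x -> f x = g x} ->
  \int[mu]_(x in U) f x = \int[mu]_(x in U) g x.
Proof.
move=> mU mf mg fg; rewrite /Rintegral; congr fine.
apply: ae_eq_integral => //; [exact/measurable_EFinP|exact/measurable_EFinP|].
by apply: filterS fg => x + Ux => /(_ Ux) ->.
Qed.

Lemma locally_integrableB U f g : open U -> locally_integrable_on U f ->
  locally_integrable_on U g -> locally_integrable_on U (f \- g).
Proof.
move=> oU [mf lf] [mg lg]; split; first exact: measurable_funB.
move=> K cK KU; have mK := measurable_compact cK.
rewrite (_ : _ \o _ = (EFin \o f) \- (EFin \o g))%E; last by apply/funext.
by apply: integrableB => //; [exact: lf|exact: lg].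
Qed.

Lemma measurable_test U phi i : test_function U phi ->
  measurable_fun U phi /\ measurable_fun U (partial i phi).
Proof.
move=> /(test_function_partial i)[c1 c2 _ _].
by split; apply: measurable_funTS; apply: (continuous_measurable_rV openT) => x _;
  [exact: c1|exact: c2].
Qed.

(** [weak_partial] is chosen among all representatives, and uniqueness gives access to its values.
    [u] and [u'] may differ on a null set because second weak derivatives start from a chosen first
    one. *)
Lemma weak_partial_unique U i u u' g g' : open U ->
  {ae mu, forall x, U x -> u x = u' x} ->
  is_weak_partial U i u g -> is_weak_partial U i u' g' ->
  {ae mu, forall x, U x -> g x = g' x}.
Proof.
move=> oU uu' [lu lg ug] [lu' lg' ug']; have mU := measurable_open oU.
suff : {ae mu, forall x, U x -> (g \- g') x = 0}.
  by apply: filterS => x H Ux; apply/eqP; rewrite -subr_eq0; apply/eqP; exact: H.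
apply: fundamental_lemma => //; first exact: locally_integrableB.
move=> phi tphi.
have [cphi cpphi dphi [K [cK KU phi0 pphi0]]] := test_function_partial i tphi.
have [mphi mpphi] := measurable_test i tphi.
have i1 := integrable_locally_integrableM oU lg cK KU cphi phi0.
have i2 := integrable_locally_integrableM oU lg' cK KU cphi phi0.
have -> : \int[mu]_(x in U) ((g \- g') x * phi x) =
    \int[mu]_(x in U) (g x * phi x - g' x * phi x).
  by apply: eq_Rintegral => x _; rewrite mulrBl.
rewrite (RintegralB mU i1 i2).
apply/eqP; rewrite subr_eq0 -eqr_opp -ug// -ug'//; apply/eqP.
apply: ae_eq_Rintegral => //.
- by apply: measurable_funM => //; exact: lu.1.
- by apply: measurable_funM => //; exact: lu'.1.
- by apply: filterS uu' => x H Ux; rewrite H.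
Qed.

Lemma weak_partial_congr U i u u' g : open U ->
  {ae mu, forall x, U x -> u x = u' x} -> locally_integrable_on U u' ->
  is_weak_partial U i u g -> is_weak_partial U i u' g.
Proof.
move=> oU uu' lu' [lu lg ug]; split => // phi tphi.
have mU := measurable_open oU; have [mphi mpphi] := measurable_test i tphi.
rewrite -ug//; apply: ae_eq_Rintegral => //.
- by apply: measurable_funM => //; exact: lu'.1.
- by apply: measurable_funM => //; exact: lu.1.
- by apply: filterS uu' => x H Ux; rewrite H.
Qed.

(* [u] is any representative of the [C^1] function [f] *)
Lemma weak_partial_ae U i u f : open U -> Ck setT U 1 f ->
  locally_integrable_on U u -> {ae mu, forall x, U x -> u x = f x} ->
  is_weak_partial U i u (weak_partial U i u) /\
  {ae mu, forall x, U x -> weak_partial U i u x = partial i f x}.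
Proof.
move=> oU Cf lu uf.
have fu : {ae mu, forall x, U x -> f x = u x}.
  by apply: filterS uf => x H Ux; rewrite H.
have wf := classical_weak_partial i oU Cf.
have wu : is_weak_partial U i u (partial i f) := weak_partial_congr oU fu lu wf.
have wu' : is_weak_partial U i u (weak_partial U i u).
  by apply: (@getPex _ [set g | is_weak_partial U i u g]); exists (partial i f).
by split => //; exact: weak_partial_unique oU uf wu' wf.
Qed.

Lemma weak_partialE U i f : open U -> Ck setT U 1 f ->
  is_weak_partial U i f (weak_partial U i f) /\
  {ae mu, forall x, U x -> weak_partial U i f x = partial i f x}.
Proof.
move=> oU Cf; apply: weak_partial_ae => //; last exact: aeW.
by apply: locally_integrable_continuous => // x Ux; exact: Ck_continuous oU Cf Ux.
Qed.

(** The outer weak derivative is taken of a mere representative of [partial j f], so the version for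
    representatives is applied. *)
Lemma weak_partial2E U i j f : open U -> Ck setT U 2 f ->
  {ae mu, forall x, U x ->
    weak_partial U i (weak_partial U j f) x = partial i (partial j f) x}.
Proof.
move=> oU Cf; have [[_ lw _] wE] := weak_partialE j oU (Ck_pred Cf).
exact: (weak_partial_ae i oU (Ck_derive _ Cf) lw wE).2.
Qed.

Lemma weak_J2E U f : open U -> Ck setT U 2 f ->
  {ae mu, forall x, U x -> weak_J2 U f x = J2 f x}.
Proof.
move=> oU Cf.
have h1 : {ae mu, forall x, forall j, U x -> weak_partial U j f x = partial j f x}.
  by apply: filter_forall => j; exact: (weak_partialE j oU (Ck_pred Cf)).2.
have h2 : {ae mu, forall x, forall ij : 'I_n * 'I_n, U x ->
    weak_partial U ij.1 (weak_partial U ij.2 f) x = partial ij.1 (partial ij.2 f) x}.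
  by apply: filter_forall => ij; exact: weak_partial2E.
apply: filterS2 h1 h2 => x H1 H2 Ux; rewrite /weak_J2 /J2; congr (_, _, _, _).
  by apply/rowP => j; rewrite !mxE H1.
by apply/matrixP => i j; rewrite !mxE (H2 (i, j)).
Qed.

End weak_partial.

Section Ck_more.
Context {R : realType} {V : normedModType R}.
Implicit Types (D : set V) (f g : V -> R).

Lemma Ck_subset D D' k f : D' `<=` D -> Ck setT D k f -> Ck setT D' k f.
Proof.
move=> DD'; elim: k f => [|k IH] f [cf Df]; split => //;
  try exact: continuous_subspaceW DD' cf.
move=> v _; have [df Cf] := Df v I; split; last exact: IH.
by move=> x /DD'; exact: df.
Qed.

Lemma Ck_eq D k f g : open D -> (forall x, D x -> f x = g x) ->
  Ck setT D k f -> Ck setT D k g.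
Proof.
move=> oD; elim: k f g => [|k IH] f g fg Cf.
  split => //; apply: subspace_eq_continuous Cf.1 => x; rewrite inE; exact: fg.
have near_fg x : D x -> \forall y \near x, f y = g y.
  by move=> Dx; apply: filterS (open_nbhs_nbhs (conj oD Dx)) => y; exact: fg.
split; first by apply: subspace_eq_continuous Cf.1 => x; rewrite inE; exact: fg.
move=> v _; split.
  by move=> x Dx; apply: (near_eq_derivable (near_fg x Dx)); exact: Ck_derivable Cf Dx.
apply: IH (Ck_derive v Cf) => x Dx.
by apply: near_eq_derive; exact: near_fg.
Qed.

Lemma Ck_add D k f g : open D -> Ck setT D k f -> Ck setT D k g ->
  Ck setT D k (fun x => f x + g x).
Proof.
move=> oD; elim: k f g => [|k IH] f g Cf Cg.
  split => //; rewrite continuous_open_subspace// => x; rewrite inE => Dx.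
  exact: (continuousD (Ck_continuous oD Cf Dx) (Ck_continuous oD Cg Dx)).
split.
  rewrite continuous_open_subspace// => x; rewrite inE => Dx.
  exact: (continuousD (Ck_continuous oD Cf Dx) (Ck_continuous oD Cg Dx)).
move=> v _; split.
  move=> x Dx; apply: (@derivableD _ _ _ f g).
    exact: Ck_derivable Cf Dx.
  exact: Ck_derivable Cg Dx.
apply: (@Ck_eq _ _ (fun x => 'D_v f x + 'D_v g x)) => //.
  move=> x Dx; apply/esym; apply: (@deriveD _ _ _ f g).
    exact: Ck_derivable Cf Dx.
  exact: Ck_derivable Cg Dx.
exact: IH (Ck_derive v Cf) (Ck_derive v Cg).
Qed.

End Ck_more.

Section J2_add.
Context {R : realType} {n : nat}.
Implicit Types (U : set 'rV[R]_n) (u f : 'rV[R]_n -> R).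

Lemma J2_add U u f x : open U -> Ck setT U 2 u -> Ck setT U 2 f -> U x ->
  J2 (fun y => u y + f y) x =
  (J2 u x + (0, f x, \row_i partial i f x, \matrix_(i, j) partial i (partial j f) x))%R.
Proof.
move=> oU Cu Cf Ux.
have E1 i y : U y -> partial i (fun y => u y + f y) y = partial i u y + partial i f y.
  move=> Uy; apply: (@deriveD _ _ _ u f).
    exact: (Ck_derivable Cu).
  exact: (Ck_derivable Cf).
have E2 i j : partial i (partial j (fun y => u y + f y)) x =
    partial i (partial j u) x + partial i (partial j f) x.
  rewrite -[RHS](@deriveD _ _ _ (partial j u) (partial j f)); last 2 first.
  - exact: (Ck_derivable (Ck_derive _ Cu)).
  - exact: (Ck_derivable (Ck_derive _ Cf)).
  apply: near_eq_derive.
  by apply: filterS (open_nbhs_nbhs (conj oU Ux)) => y; exact: E1.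
rewrite /J2 !add_pairE addr0; congr (_, _, _, _).
  by apply/rowP => i; rewrite !mxE E1.
apply/matrixP => i j; rewrite [LHS]mxE (E2 i j) [RHS]mxE.
by congr (_ + _); rewrite mxE.
Qed.

End J2_add.

(** * Radial bumps *)

Section radial.
Context {R : realType} {n : nat}.
Variables (x0 : 'rV[R]_n) (r : R).
Implicit Types (y v : 'rV[R]_n) (F : R -> R).

(** [r] is the squared radius, so no square root occurs; the gap is positive inside the ball and
    zero on the sphere. *)
Definition sqgap y : R := r - dotr (y - x0) (y - x0).

Lemma smooth_sqgap : smooth sqgap.
Proof.
rewrite (_ : sqgap = fun y => r + (-1) * \sum_i (y ord0 i - x0 ord0 i) * (y ord0 i - x0 ord0 i)).
  apply: smooth_add; first exact: smooth_cst.
  apply: smooth_mul; first exact: smooth_cst.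
  by apply: smooth_sum => i; apply: smooth_mul; exact: smooth_coordB.
apply/funext => y; rewrite /sqgap mulN1r; congr (_ - _).
by apply: eq_bigr => i _; rewrite !mxE.
Qed.

Lemma is_derive_sqgap y v : is_derive y v sqgap (- 2 * dotr (y - x0) v).
Proof.
have d1 i : is_derive y v (fun y : 'rV[R]_n => (y - x0) ord0 i) (v ord0 i).
  rewrite (_ : (fun _ => _) = (fun y : 'rV[R]_n => y ord0 i) - cst (x0 ord0 i)).
    by rewrite -[v ord0 i]subr0; apply: is_deriveB; exact: is_derive_coord.
  by apply/funext => z; rewrite !mxE.
have d2 i : is_derive y v (fun y : 'rV[R]_n => (y - x0) ord0 i * (y - x0) ord0 i)
    ((y - x0) ord0 i * v ord0 i + (y - x0) ord0 i * v ord0 i).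
  exact: is_deriveM (d1 i) (d1 i).
have d3 := is_derive_sum d2.
have -> : sqgap = cst r - \sum_(i < n) (fun y : 'rV[R]_n => (y - x0) ord0 i * (y - x0) ord0 i).
  by apply/funext => z; rewrite /sqgap /dotr !fctE fct_sumE.
have d4 := is_deriveB (is_derive_cst r y v) d3.
apply: is_derive_eq d4 _.
by rewrite big_split/= sub0r /dotr; ring.
Qed.

Lemma is_derive_radial F (dF : R) y i : is_derive (sqgap y) (1 : R) F dF ->
  is_derive y (delta_mx ord0 i) (F \o sqgap) (- 2 * dF * (y - x0) ord0 i).
Proof.
move=> FdF; have ds := (smoothP smooth_sqgap y).1.
have [d _] := is_derive_comp (delta_mx ord0 i) FdF ds.
apply: is_derive_eq d _.
rewrite -(deriveE _ ds) (@derive_val _ _ _ _ _ _ _ (is_derive_sqgap y (delta_mx ord0 i))).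
rewrite /dotr (bigD1 i)//= big1 ?addr0; last first.
  by move=> j ji; rewrite !mxE (negbTE ji) andbF mulr0.
by rewrite [delta_mx _ _ _ _]mxE !eqxx mulr1 mulrCA mulrA [_ * dF]mulrC.
Qed.

Lemma partial_radial F F1 i : (forall t, is_derive t (1 : R) F (F1 t)) ->
  partial i (F \o sqgap) = fun y => - 2 * F1 (sqgap y) * (y - x0) ord0 i.
Proof.
move=> dF; apply/funext => y.
by rewrite /partial (@derive_val _ _ _ _ _ _ _ (is_derive_radial i (dF (sqgap y)))).
Qed.

Lemma partial2_radial F F1 F2 i j : (forall t, is_derive t (1 : R) F (F1 t)) ->
  (forall t, is_derive t (1 : R) F1 (F2 t)) ->
  partial i (partial j (F \o sqgap)) = fun y =>
    4 * F2 (sqgap y) * (y - x0) ord0 i * (y - x0) ord0 j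
    - 2 * F1 (sqgap y) * (i == j)%:R.
Proof.
move=> dF dF1; rewrite (partial_radial j dF); apply/funext => y.
have d1 := is_derive_radial i (dF1 (sqgap y)).
have d2 : is_derive y (delta_mx ord0 i) (fun y : 'rV[R]_n => (y - x0) ord0 j) ((i == j)%:R).
  rewrite (_ : (fun _ => _) = (fun y : 'rV[R]_n => y ord0 j) - cst (x0 ord0 j)).
    rewrite -[_%:R]subr0; apply: is_deriveB.
    by apply: is_derive_eq (is_derive_coord _ _ _) _; rewrite mxE eqxx eq_sym.
  by apply/funext => z; rewrite !mxE.
have d3 := is_deriveM d1 d2.
have d4 := is_deriveZ (- 2) d3.
rewrite /partial.
have -> : (fun y0 => - 2 * F1 (sqgap y0) * (y0 - x0) ord0 j) =
    (- 2) *: ((F1 \o sqgap) * (fun y : 'rV[R]_n => (y - x0) ord0 j)).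
  by apply/funext => z; rewrite !fctE -mulrA.
rewrite (@derive_val _ _ _ _ _ _ _ d4) /= /GRing.scale/=; ring.
Qed.

End radial.

(** * One-variable approximations of the square *)

Section approximation.
Context {R : realType}.
Implicit Types (a t b : R).

(* Smooth in [t], zero for [t <= 0], converging to [t ^+ 2] as [a] tends to [0]
   with second derivatives bounded uniformly in [a]: composed with [sqgap - a]
   this gives the test functions approximating the bump. *)
Definition sqflat a t : R := t ^+ 2 * flat 1 a t.
(** This and [sqflat2] are the successive derivatives of [sqflat a]; the singular factor [a / t ^ 2]
    from differentiating the exponential is cancelled by [t ^ 2]. *)
Definition sqflat1 a t : R := (2 * t + a) * flat 1 a t.
Definition sqflat2 a t : R := 2 * flat 1 a t + (2 * t + a) * flat (dflat 1 a) a t.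

Let sqr_flat a t : t ^+ 2 * flat (dflat 1 a) a t = a * flat 1 a t.
Proof.
rewrite /flat; case: ifPn => t0; last by rewrite !mulr0.
rewrite /dflat derivC subr0 hornerM hornerXn hornerZ hornerC mulr1 mul1r.
by field; rewrite gt_eqF.
Qed.

Lemma is_derive_expr2 t : is_derive t (1 : R) (fun t => t ^+ 2) (2 * t).
Proof.
have -> : (fun t : R => t ^+ 2) = id * id by apply/funext => s; rewrite expr2.
have d := is_deriveM (is_derive_id t (1 : R)) (is_derive_id t (1 : R)).
by apply: is_derive_eq d _; rewrite [_ *: _]mulr1 mulr_natl.
Qed.

Lemma is_derive_sqflat a t : 0 < a -> is_derive t (1 : R) (sqflat a) (sqflat1 a t).
Proof.
move=> a0; have d := is_deriveM (is_derive_expr2 t) (is_derive_flat 1 t a0).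
apply: is_derive_eq d _.
by rewrite /sqflat1 [(2 * t + a) * _]mulrDl -(sqr_flat a t) addrC; congr (_ + _); rewrite [LHS]mulrC.
Qed.

Lemma is_derive_sqflat1 a t : 0 < a -> is_derive t (1 : R) (sqflat1 a) (sqflat2 a t).
Proof.
move=> a0; have d1 : is_derive t (1 : R) (fun t : R => 2 * t + a) 2.
  have d2 := is_deriveD (is_deriveZ 2 (is_derive_id t (1 : R))) (is_derive_cst a t (1 : R)).
  by apply: is_derive_eq d2 _; rewrite addr0 [LHS]mulr1.
have d := is_deriveM d1 (is_derive_flat 1 t a0).
apply: is_derive_eq d _.
by rewrite /sqflat2 addrC; congr (_ + _); rewrite [LHS]mulrC.
Qed.

Let flat_neg p a t : t <= 0 -> flat p a t = 0.
Proof. by move=> t0; rewrite /flat ltNge t0. Qed.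

Let flat1_le a t : 0 < a -> 0 < t -> (1 + a / t) * flat 1 a t <= 1.
Proof.
move=> a0 t0; rewrite /flat t0 hornerC mul1r mulNr expRN.
by rewrite ler_pdivrMr ?expR_gt0// mul1r expR_ge1Dx.
Qed.

Let flat1_le2 a t : 0 < a -> 0 < t -> (a / t) ^+ 2 * flat 1 a t <= 2.
Proof.
move=> a0 t0; rewrite /flat t0 hornerC mul1r mulNr expRN.
rewrite ler_pdivrMr ?expR_gt0//.
have := expR_ge1Dxn 1 (divr_ge0 (ltW a0) (ltW t0)).
by rewrite (_ : 2`!%:R = 2 :> R)//; lra.
Qed.

Lemma sqflat_bound a t : 0 < a -> `|sqflat a t| <= t ^+ 2.
Proof.
move=> a0; have /andP[f0 f1] := flat1_itv t a0.
rewrite /sqflat ger0_norm; last by rewrite mulr_ge0// sqr_ge0.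
by apply: ler_piMr => //; exact: sqr_ge0.
Qed.

Lemma sqflat1_bound a t : 0 < a -> `|sqflat1 a t| <= 2 * `|t|.
Proof.
move=> a0; have [t0|t0] := leP t 0.
  by rewrite /sqflat1 flat_neg// mulr0 normr0 mulr_ge0.
have /andP[f0 f1] := flat1_itv t a0; have H := flat1_le a0 t0.
rewrite /sqflat1 (gtr0_norm t0) ger0_norm; last first.
  by rewrite mulr_ge0// addr_ge0 ?mulr_ge0// ltW.
have -> : (2 * t + a) * flat 1 a t = t * flat 1 a t + t * ((1 + a / t) * flat 1 a t).
  by field; rewrite gt_eqF.
have h1 : t * flat 1 a t <= t by rewrite ler_piMr// ltW.
have h2 : t * ((1 + a / t) * flat 1 a t) <= t by rewrite ler_piMr// ltW.
lra.
Qed.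

(** For [t > 0] and [x = a / t] the value is [2 (1 + x) exp(- x) + x ^ 2 exp(- x)], and [exp(x)]
    dominates both [1 + x] and [x ^ 2 / 2]. Independence of [a] permits dominated convergence. *)
Lemma sqflat2_bound a t : 0 < a -> `|sqflat2 a t| <= 6.
Proof.
move=> a0; have [t0|t0] := leP t 0.
  by rewrite /sqflat2 !flat_neg// !mulr0 addr0 normr0.
have /andP[f0 f1] := flat1_itv t a0; have H := flat1_le a0 t0; have H2 := flat1_le2 a0 t0.
have E : flat (dflat 1 a) a t = a / t ^+ 2 * flat 1 a t.
  by rewrite mulrAC -sqr_flat mulrC mulKf// sqrf_eq0 gt_eqF.
rewrite /sqflat2 E.
have -> : 2 * flat 1 a t + (2 * t + a) * (a / t ^+ 2 * flat 1 a t) =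
    2 * ((1 + a / t) * flat 1 a t) + (a / t) ^+ 2 * flat 1 a t.
  by field; rewrite gt_eqF.
rewrite ger0_norm.
  by lra.
by rewrite addr_ge0// mulr_ge0// ?sqr_ge0// mulr_ge0// addr_ge0// divr_ge0// ltW.
Qed.

Let eps (m : nat) : R := m.+1%:R^-1.

Let eps_gt0 m : 0 < eps m. Proof. by rewrite invr_gt0 ltr0n. Qed.

Let cvg_eps : eps m @[m --> \oo] --> (0 : R). Proof. exact: cvg_harmonic. Qed.

Let cvg_shift_eps t : t - eps m @[m --> \oo] --> t.
Proof.
rewrite -[X in _ --> X]subr0; apply: cvgB; first exact: cvg_cst.
exact: cvg_eps.
Qed.

Let cvg_flat_shift t : 0 < t -> flat 1 (eps m) (t - eps m) @[m --> \oo] --> (1 : R).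
Proof.
move=> t0; have near_pos : \forall m \near \oo, 0 < t - eps m.
  by have := @cvg_shift_eps t; move=> /cvgr_gt; apply.
have E : \forall m \near \oo, expR (- eps m / (t - eps m)) = flat 1 (eps m) (t - eps m).
  by apply: filterS near_pos => m h; rewrite /flat h hornerC mul1r.
apply: cvg_trans (near_eq_cvg E) _.
suff : expR (- eps m / (t - eps m)) @[m --> \oo] --> expR (- 0 * t^-1).
  by rewrite oppr0 mul0r expR0; apply.
apply: continuous_cvg; first exact: continuous_expR.
apply: cvgM; first by apply: cvgN; exact: cvg_eps.
by apply: cvgV; [rewrite gt_eqF|exact: cvg_shift_eps].
Qed.

Lemma cvg_sqflat t : 0 < t -> sqflat (eps m) (t - eps m) @[m --> \oo] --> t ^+ 2.
Proof.
move=> t0; rewrite -[X in _ --> X]mulr1; apply: cvgM; last exact: cvg_flat_shift.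
by rewrite expr2; under eq_fun do rewrite expr2; apply: cvgM; exact: cvg_shift_eps.
Qed.

Lemma cvg_sqflat1 t : 0 < t -> sqflat1 (eps m) (t - eps m) @[m --> \oo] --> 2 * t.
Proof.
move=> t0; rewrite -[X in _ --> X]mulr1; apply: cvgM; last exact: cvg_flat_shift.
rewrite -[X in _ --> X]addr0; apply: cvgD; last exact: cvg_eps.
by apply: cvgM; [exact: cvg_cst|exact: cvg_shift_eps].
Qed.

Lemma cvg_sqflat2 t : 0 < t -> sqflat2 (eps m) (t - eps m) @[m --> \oo] --> (2 : R).
Proof.
move=> t0.
have near_pos : \forall m \near \oo, 0 < t - eps m.
  by have := @cvg_shift_eps t; move=> /cvgr_gt; apply.
have E : \forall m \near \oo, 2 * flat 1 (eps m) (t - eps m) +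
    (2 * (t - eps m) + eps m) * (eps m * (t - eps m)^-1 * (t - eps m)^-1 * flat 1 (eps m) (t - eps m)) =
    sqflat2 (eps m) (t - eps m).
  apply: filterS near_pos => m h; rewrite /sqflat2; congr (_ + _ * _).
  rewrite mulrAC [_ * _ * flat _ _ _]mulrAC -sqr_flat expr2.
  by field; rewrite gt_eqF.
apply: cvg_trans (near_eq_cvg E) _.
have cV : (t - eps m)^-1 @[m --> \oo] --> t^-1.
  by apply: cvgV; [rewrite gt_eqF|exact: cvg_shift_eps].
suff : 2 * flat 1 (eps m) (t - eps m) +
    (2 * (t - eps m) + eps m) * (eps m * (t - eps m)^-1 * (t - eps m)^-1 * flat 1 (eps m) (t - eps m))
    @[m --> \oo] --> 2 * 1 + (2 * t + 0) * (0 * t^-1 * t^-1 * 1).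
  by rewrite (_ : 2 * 1 + (2 * t + 0) * (0 * t^-1 * t^-1 * 1) = 2); [apply|ring].
apply: cvgD.
  by apply: cvgM; [exact: cvg_cst|exact: cvg_flat_shift].
apply: cvgM.
  apply: cvgD; last exact: cvg_eps.
  by apply: cvgM; [exact: cvg_cst|exact: cvg_shift_eps].
apply: cvgM; last exact: cvg_flat_shift.
by apply: cvgM => //; apply: cvgM => //; exact: cvg_eps.
Qed.

End approximation.

(** * Sobolev regularity of the bump *)

Section bounded_sobolev.
Context {R : realType} {n : nat}.
Implicit Types (A K : set 'rV[R]_n) (f g : 'rV[R]_n -> R).
Local Notation mu := (lebesgue_rV R n).

Lemma bounded_in_Lp A f (C : R) (p : \bar R) : measurable A -> (mu A < +oo)%E ->
  measurable_fun A f -> (forall x, A x -> `|f x| <= C) ->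
  p = 1%E \/ p = +oo%E -> in_Lp p A f.
Proof.
move=> mA Afin mf fC [->|->]; split => //.
  rewrite Lnorm1.
  have -> : (\int[mu]_x `|(EFin \o (f \_ A)) x| = \int[mu]_(x in A) `|(f x)%:E|)%E.
    rewrite [RHS]integral_mkcond; apply: eq_integral => x _.
    by rewrite /= !patchE; case: ifP => _ //=; rewrite normr0.
  have : mu.-integrable A (EFin \o f).
    apply: measurable_bounded_integrable => //.
    exists C; split; first exact: num_real.
    by move=> C' CC' x Ax; exact: le_trans (fC x Ax) (ltW CC').
  by move/integrableP => [_].
rewrite unlock /=; case: ifP => _ //.
(* The restricted function is zero off [A], hence the maximum with [0]. *)
apply: (@le_lt_trans _ _ (Num.max C 0)%:E); last exact: ltry.
apply/ess_supP; apply: aeW => x /=; rewrite patchE lee_fin le_max.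
by case: ifPn => [|_]; [rewrite inE => /fC ->|rewrite normr0 lexx orbT].
Qed.

Lemma smooth_in_Wkp A K f k (p : \bar R) : open A -> compact K -> A `<=` K ->
  p = 1%E \/ p = +oo%E -> smooth f -> in_Wkp k p A f.
Proof.
move=> oA cK AK hp.
have mA := measurable_open oA.
have Afin : (mu A < +oo)%E.
  apply: le_lt_trans (compact_fin cK); apply: le_measure; rewrite ?inE//.
  exact: measurable_compact.
have Lp g : smooth g -> in_Lp p A g.
  move=> sg; have cg := smooth_continuous sg.
  have /compact_bounded[B [_ HB]] : compact (g @` K).
    by apply: continuous_compact => //; exact: continuous_subspaceT.
  apply: (@bounded_in_Lp _ _ (B + 1)) => //.
    by apply: measurable_funTS; exact: (continuous_measurable_rV openT (fun x _ => cg x)).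
  by move=> x /AK Kx; apply: (HB (B + 1)); [rewrite ltrDl|exists x].
elim: k f => [|k IH] f sf; split => //; try exact: Lp.
move=> i; exists (partial i f).
  apply: classical_weak_partial => //; apply: (@Ck_subset _ _ setT) => //.
  exact: smooth_Ck.
by apply: IH; exact: (smoothP sf 0).2.
Qed.

(** Exchanges a chosen weak derivative [f] for the classical one [g] inside the norm. *)
Lemma Lnorm1_ae A f g : measurable A -> measurable_fun A f -> measurable_fun A g ->
  {ae mu, forall x, A x -> f x = g x} ->
  ('N[mu]_1[EFin \o (f \_ A)] = \int[mu]_(x in A) `|(g x)%:E|)%E.
Proof.
move=> mA mf mg fg; rewrite Lnorm1.
have -> : (\int[mu]_x `|(EFin \o (f \_ A)) x| = \int[mu]_(x in A) `|(f x)%:E|)%E.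
  rewrite [RHS]integral_mkcond; apply: eq_integral => x _.
  by rewrite /= !patchE; case: ifP => _ //=; rewrite normr0.
apply: ae_eq_integral => //.
- by apply: measurableT_comp => //; exact/measurable_EFinP.
- by apply: measurableT_comp => //; exact/measurable_EFinP.
- by apply: filterS fg => x + Ax => /(_ Ax) ->.
Qed.

Lemma bounded_cvg_L1 A (f : nat -> 'rV[R]_n -> R) (C : R) :
  measurable A -> (mu A < +oo)%E -> (forall m, measurable_fun A (f m)) ->
  (forall m x, A x -> `|f m x| <= C) ->
  (forall x, A x -> f m x @[m --> \oo] --> (0 : R)) ->
  (\int[mu]_(x in A) `|(f m x)%:E| @[m --> \oo] --> 0)%E.
Proof.
move=> mA Afin mf fC f0.
have mfE m : measurable_fun A (EFin \o f m) by exact/measurable_EFinP.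
have f0E x : A x -> (EFin \o f m) x @[m --> \oo] --> 0%E.
  by move=> Ax; apply: cvg_EFin; [exact: nearW|exact: f0].
have iC : mu.-integrable A (cst C%:E).
  apply: (@measurable_bounded_integrable _ _ _ _ (cst C)) => //.
  exists `|C|; split; first exact: num_real.
  by move=> C' CC' x _; exact: ltW.
have fCE x m : A x -> (`|(EFin \o f m) x| <= C%:E)%E.
  by move=> Ax; rewrite lee_fin; exact: fC.
have [_ + _] := dominated_convergence mA mfE (measurable_cst 0%E) (aeW _ f0E) iC (aeW _ fCE).
by under eq_fun do under eq_integral do rewrite sube0.
Qed.

Lemma cvg_adde0 (f g : nat -> \bar R) :
  f m @[m --> \oo] --> 0%E -> g m @[m --> \oo] --> 0%E ->
  (f m + g m)%E @[m --> \oo] --> 0%E.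
Proof. by move=> f0 g0; have := cvgeD (fin_num_adde_defr _ _) f0 g0; rewrite adde0; apply. Qed.

Lemma cvg_sume0 (I : Type) (s : seq I) (f : I -> nat -> \bar R) :
  (forall i, f i m @[m --> \oo] --> 0%E) ->
  (\sum_(i <- s) f i m)%E @[m --> \oo] --> 0%E.
Proof.
move=> f0; elim: s => [|i s IH].
  by under eq_fun do rewrite big_nil; exact: cvg_cst.
under eq_fun do rewrite big_cons.
exact: cvg_adde0.
Qed.

End bounded_sobolev.

Section bump.
Context {R : realType} {n : nat}.
Variables (x0 : 'rV[R]_n) (r b : R).
Local Notation mu := (lebesgue_rV R n).
Local Notation s := (sqgap x0 r).

Definition eball : set 'rV[R]_n := [set y | 0 < s y].
Definition ecball : set 'rV[R]_n := [set y | 0 <= s y].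
(** Not truncated outside the ball: membership in [in_W2inf0] and the functional on the ball see
    only the values inside, so a polynomial serves. *)
Definition sqbump (y : 'rV[R]_n) : R := b * s y ^+ 2.

Let cs : continuous s. Proof. exact: smooth_continuous (smooth_sqgap x0 r). Qed.

Lemma open_eball : open eball.
Proof.
rewrite (_ : eball = s @^-1` `]0, +oo[%classic).
  by apply: open_comp => [y _|]; [exact: cs|exact: interval_open].
by apply/seteqP; split => y /=; rewrite in_itv/= andbT.
Qed.

Lemma closed_sqgap_ge (c : R) : closed [set y | c <= s y].
Proof.
rewrite (_ : [set y | _] = s @^-1` `[c, +oo[%classic).
  by apply: closed_comp => [y _|]; [exact: cs|exact: interval_closed].
by apply/seteqP; split => y /=; rewrite in_itv/= andbT.
Qed.

(** [r + 1] dominates the radius, the square root of [r], without naming it. *)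
Lemma sqgap_coord y i : 0 <= s y -> `|(y - x0) ord0 i| <= r + 1.
Proof.
rewrite subr_ge0 => sy; have : (y - x0) ord0 i ^+ 2 <= r.
  apply: le_trans sy; rewrite /dotr (bigD1 i)//= expr2 lerDl.
  by apply: sumr_ge0 => j _; rewrite -expr2 sqr_ge0.
rewrite -real_normK ?num_real// => h.
rewrite leNgt; apply/negP => h'; have := normr_ge0 ((y - x0) ord0 i); nra.
Qed.

Lemma compact_sqgap_ge (c : R) : 0 <= c -> compact [set y | c <= s y].
Proof.
move=> c0; apply: (@subclosed_compact _ _ (cbox (x0 - const_mx (r + 1)) (x0 + const_mx (r + 1)))).
- exact: closed_sqgap_ge.
- exact: cbox_compact.
move=> y /= cy i; have := sqgap_coord i (le_trans c0 cy).
by rewrite !mxE ler_norml => /andP[h1 h2]; apply/andP; split; lra.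
Qed.

Lemma compact_ecball : compact ecball. Proof. exact: compact_sqgap_ge. Qed.

Lemma eball_ecball : eball `<=` ecball. Proof. by move=> y /ltW. Qed.

Let mA : measurable eball. Proof. exact: measurable_open open_eball. Qed.

Let Afin : (mu eball < +oo)%E.
Proof.
apply: le_lt_trans (compact_fin compact_ecball); apply: le_measure; rewrite ?inE//.
  exact: measurable_compact compact_ecball.
exact: eball_ecball.
Qed.

Lemma smooth_bump : smooth sqbump.
Proof.
rewrite (_ : sqbump = fun y => b * (s y * s y)); last first.
  by apply/funext => y; rewrite /sqbump expr2.
apply: smooth_mul; first exact: smooth_cst.
by apply: smooth_mul; exact: smooth_sqgap.
Qed.

Let eps (m : nat) : R := m.+1%:R^-1.
Let eps_gt0 m : 0 < eps m. Proof. by rewrite invr_gt0 ltr0n. Qed.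
Let eps_le1 m : eps m <= 1. Proof. by rewrite invf_le1 ?ltr0n// ler1n. Qed.

(** The shift by [eps m] moves the support into the compact set [eps m <= s y] of the open ball;
    without it the support would reach the sphere. *)
Definition bump_approx (m : nat) (y : 'rV[R]_n) : R := b * sqflat (eps m) (s y - eps m).

Lemma smooth_bump_approx m : smooth (bump_approx m).
Proof.
have ss : smooth (fun y => s y - eps m).
  by apply: smooth_add; [exact: smooth_sqgap|exact: smooth_cst].
rewrite (_ : bump_approx m = fun y => b * ((s y - eps m) * (s y - eps m) *
    flat 1 (eps m) (s y - eps m))); last first.
  by apply/funext => y; rewrite /bump_approx /sqflat expr2.
apply: smooth_mul; first exact: smooth_cst.
by apply: smooth_mul; [exact: smooth_mul|exact: smooth_flat].
Qed.

Lemma test_bump_approx m : test_function eball (bump_approx m).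
Proof.
split; first by move=> k; apply: smooth_Ck; exact: smooth_bump_approx.
exists [set y | eps m <= s y]; split.
- by apply: compact_sqgap_ge; exact: ltW.
- by move=> y /=; exact: lt_le_trans.
- move=> y /= /negP; rewrite -ltNge => h.
  by rewrite /bump_approx /sqflat /flat subr_gt0 ltNge (ltW h)/= !mulr0.
Qed.

(** The approximation error and its first two derivatives as functions of the gap, which reduces all
    estimates to one variable. *)
Let F m (t : R) := b * (sqflat (eps m) (t - eps m) - t ^+ 2).
Let F1 m (t : R) := b * (sqflat1 (eps m) (t - eps m) - 2 * t).
Let F2 m (t : R) := b * (sqflat2 (eps m) (t - eps m) - 2).

Let is_derive_shiftB (f : R -> R) (c t d : R) : is_derive (t - c) (1 : R) f d ->
  is_derive t (1 : R) (fun t => f (t - c)) d.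
Proof.
move=> df; have dc : is_derive t (1 : R) (fun t => t - c) 1.
  have := is_deriveB (is_derive_id t (1 : R)) (is_derive_cst c t (1 : R)).
  by rewrite subr0.
by have := @is_derive1_comp _ f (fun t => t - c) t d 1 df dc; rewrite mulr1.
Qed.

Let dF m t : is_derive t (1 : R) (F m) (F1 m t).
Proof.
have d1 := is_derive_shiftB (is_derive_sqflat (t - eps m) (eps_gt0 m)).
have d := is_deriveZ b (is_deriveB d1 (is_derive_expr2 t)).
by apply: (is_derive_eq d).
Qed.

Let dF1 m t : is_derive t (1 : R) (F1 m) (F2 m t).
Proof.
have d1 := is_derive_shiftB (is_derive_sqflat1 (t - eps m) (eps_gt0 m)).
have d2 : is_derive t (1 : R) (fun t : R => 2 * t) 2.
  have d2 := is_deriveZ 2 (is_derive_id t (1 : R)).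
  by apply: is_derive_eq d2 _; rewrite [LHS]mulr1.
by have d := is_deriveZ b (is_deriveB d1 d2); apply: (is_derive_eq d).
Qed.

Let err m : 'rV[R]_n -> R := F m \o s.

Let errE m : (fun x => bump_approx m x - sqbump x) = err m.
Proof. by apply/funext => x; rewrite /err /F /= mulrBr. Qed.

Let C_err m : Ck setT eball 2 (err m).
Proof.
apply: (@Ck_subset _ _ setT) => //; apply: smooth_Ck.
rewrite -errE (_ : (fun _ => _) = fun x => bump_approx m x + (-1) * sqbump x).
  apply: smooth_add; first exact: smooth_bump_approx.
  by apply: smooth_mul; [exact: smooth_cst|exact: smooth_bump].
by apply/funext => x; rewrite mulN1r.
Qed.

Let s_le y : s y <= r. Proof. by rewrite lerBlDr lerDl dotr_ge0. Qed.

Let F_bound m t : 0 < t <= r -> `|F m t| <= `|b| * (2 * (r + 1) ^+ 2).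
Proof.
move=> /andP[t0 tr]; rewrite normrM ler_wpM2l//.
have := sqflat_bound (t - eps m) (eps_gt0 m); have := eps_gt0 m; have := eps_le1 m.
move: (sqflat (eps m) (t - eps m)) (eps m) => A e e1 e0; rewrite ler_norml => /andP[h1 h2].
by rewrite ler_norml; apply/andP; split; nra.
Qed.

Let F1_bound m t : 0 < t <= r -> `|F1 m t| <= `|b| * (4 * (r + 1)).
Proof.
move=> /andP[t0 tr]; rewrite normrM ler_wpM2l//.
have := sqflat1_bound (t - eps m) (eps_gt0 m); have := eps_gt0 m; have := eps_le1 m.
move: (sqflat1 (eps m) (t - eps m)) (eps m) => A e e1 e0 h.
have te : `|t - e| <= r + 1 by rewrite ler_norml; apply/andP; split; lra.
move: h; rewrite ler_norml => /andP[h1 h2].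
by rewrite ler_norml; apply/andP; split; lra.
Qed.

(** [8 = 6 + 2]: the uniform bound on [sqflat2] plus the second derivative of the square. *)
Let F2_bound m t : `|F2 m t| <= `|b| * 8.
Proof.
rewrite normrM ler_wpM2l//.
have := sqflat2_bound (t - eps m) (eps_gt0 m).
by rewrite !ler_norml => /andP[h1 h2]; apply/andP; split; lra.
Qed.

Let F_cvg t : 0 < t -> F m t @[m --> \oo] --> (0 : R).
Proof.
move=> t0; rewrite -(mulr0 b) -(subrr (t ^+ 2)); apply: cvgM; first exact: cvg_cst.
by apply: cvgB; [exact: cvg_sqflat|exact: cvg_cst].
Qed.

Let F1_cvg t : 0 < t -> F1 m t @[m --> \oo] --> (0 : R).
Proof.
move=> t0; rewrite -(mulr0 b) -(subrr (2 * t)); apply: cvgM; first exact: cvg_cst.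
by apply: cvgB; [exact: cvg_sqflat1|exact: cvg_cst].
Qed.

Let F2_cvg t : 0 < t -> F2 m t @[m --> \oo] --> (0 : R).
Proof.
move=> t0; rewrite -(mulr0 b) -(subrr (2 : R)); apply: cvgM; first exact: cvg_cst.
by apply: cvgB; [exact: cvg_sqflat2|exact: cvg_cst].
Qed.

(** Values, gradients and Hessians of the error stay bounded and tend to zero pointwise in the open
    ball, which has finite measure; this gives L^1 convergence, all that the closure in W^{2,1}
    asks, without uniform control near the sphere. *)
Lemma bump_W2inf0 : in_W2inf0 eball sqbump.
Proof.
have W k p : p = 1%E \/ p = +oo%E -> in_Wkp k p eball sqbump.
  move=> hp; apply: smooth_in_Wkp open_eball compact_ecball eball_ecball hp _.
  exact: smooth_bump.
split; first by apply: W; right.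
split; first by apply: W; left.
exists bump_approx; first exact: test_bump_approx.
under eq_fun do rewrite errE.
have A_in y : eball y -> 0 < s y <= r by move=> ys; rewrite s_le andbT.
have cerr m : measurable_fun eball (err m).
  by apply: (continuous_measurable_rV open_eball) => y Ay; exact: Ck_continuous open_eball (C_err m) Ay.
have cperr m i : measurable_fun eball (partial i (err m)).
  apply: (continuous_measurable_rV open_eball) => y Ay.
  exact: Ck_continuous open_eball (Ck_derive _ (C_err m)) Ay.
have cpperr m i j : measurable_fun eball (partial i (partial j (err m))).
  apply: (continuous_measurable_rV open_eball) => y Ay.
  exact: Ck_continuous open_eball (Ck_derive _ (Ck_derive _ (C_err m))) Ay.
have W1 m i := weak_partialE i open_eball (Ck_pred (C_err m)).
have W2 m i j := weak_partial_ae i open_eball (Ck_derive _ (C_err m))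
  (let: And3 _ l _ := (W1 m j).1 in l) (W1 m j).2.
have L0 : (\int[mu]_(y in eball) `|(err m y)%:E|)%E @[m --> \oo] --> 0%E.
  apply: (bounded_cvg_L1 mA Afin cerr (C := `|b| * (2 * (r + 1) ^+ 2))).
    by move=> m y Ay; apply: F_bound; exact: A_in.
  by move=> y Ay; exact: F_cvg.
have L1 i : (\int[mu]_(y in eball) `|(partial i (err m) y)%:E|)%E @[m --> \oo] --> 0%E.
  apply: (bounded_cvg_L1 mA Afin (cperr^~ i)
      (C := 2 * (`|b| * (4 * (r + 1))) * (r + 1))).
    move=> m y Ay; rewrite (partial_radial _ _ i (dF m)).
    have := F1_bound m (A_in y Ay); move: (F1 m (s y)) => B HB.
    rewrite !normrM normrN [`|2|]ger0_norm//.
    by apply: ler_pM; [exact: mulr_ge0|exact: normr_ge0|exact: ler_wpM2l|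
      apply: sqgap_coord; exact: eball_ecball].
  move=> y Ay; under eq_fun do rewrite (partial_radial _ _ i (dF _)).
  rewrite -(mul0r ((y - x0) ord0 i)); apply: cvgM; last exact: cvg_cst.
  rewrite -(mulr0 (- 2)); apply: cvgM; first exact: cvg_cst.
  exact: F1_cvg.
have L2 i j : (\int[mu]_(y in eball) `|(partial i (partial j (err m)) y)%:E|)%E @[m --> \oo] --> 0%E.
  apply: (bounded_cvg_L1 mA Afin (fun m => cpperr m i j)
      (C := 4 * (`|b| * 8) * (r + 1) * (r + 1) + 2 * (`|b| * (4 * (r + 1))))).
    move=> m y Ay; rewrite (partial2_radial _ _ i j (dF m) (dF1 m)).
    have := F1_bound m (A_in y Ay); have := F2_bound m (s y).
    move: (F1 m (s y)) (F2 m (s y)) => B1 B2 HB2 HB1.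
    apply: le_trans (ler_normB _ _) _; apply: lerD.
      rewrite !normrM [`|4|]ger0_norm//; have [h1 h2] :
        `|(y - x0) ord0 i| <= r + 1 /\ `|(y - x0) ord0 j| <= r + 1.
        by split; apply: sqgap_coord; exact: eball_ecball.
      apply: ler_pM; [by rewrite !mulr_ge0|exact: normr_ge0| |exact: h2].
      apply: ler_pM; [by rewrite !mulr_ge0|exact: normr_ge0| |exact: h1].
      exact: ler_wpM2l.
    rewrite !normrM [`|2|]ger0_norm//.
    apply: (@le_trans _ _ (2 * `|B1|)); last exact: ler_wpM2l.
    by rewrite ler_piMr ?mulr_ge0//; case: eqP => _; rewrite ?normr1 ?normr0.
  move=> y Ay; under eq_fun do rewrite (partial2_radial _ _ i j (dF _) (dF1 _)).
  suff : 4 * F2 m (s y) * (y - x0) ord0 i * (y - x0) ord0 j - 2 * F1 m (s y) * (i == j)%:R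
      @[m --> \oo] --> 4 * 0 * (y - x0) ord0 i * (y - x0) ord0 j - 2 * 0 * (i == j)%:R.
    by rewrite !mulr0 !mul0r subr0; apply.
  apply: cvgB.
    apply: cvgM; last exact: cvg_cst.
    apply: cvgM; last exact: cvg_cst.
    by apply: cvgM; [exact: cvg_cst|exact: F2_cvg].
  apply: cvgM; last exact: cvg_cst.
  by apply: cvgM; [exact: cvg_cst|exact: F1_cvg].
have mW1 m i : measurable_fun eball (weak_partial eball i (err m)).
  by have [[_ [+ _] _] _] := W1 m i.
have mW2 m i j : measurable_fun eball (weak_partial eball i (weak_partial eball j (err m))).
  by have [[_ [+ _] _] _] := W2 m i j.
rewrite /norm_Wkp.
have E0 m := Lnorm1_ae mA (cerr m) (cerr m) (aeW _ (fun x _ => erefl (err m x))).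
have E1 m i := Lnorm1_ae mA (mW1 m i) (cperr m i) (W1 m i).2.
have E2 m i j := Lnorm1_ae mA (mW2 m i j) (cpperr m i j) (W2 m i j).2.
apply: cvg_adde0.
  exact: cvg_trans (near_eq_cvg (nearW _ (fun m => esym (E0 m)))) L0.
apply: cvg_sume0 => i.
apply: cvg_adde0.
  exact: cvg_trans (near_eq_cvg (nearW _ (fun m => esym (E1 m i)))) (L1 i).
apply: cvg_sume0 => j.
(* [norm_Wkp] differentiates first along the outer summation index, so the two indices trade
   places. *)
apply: cvg_trans (L2 j i); apply: near_eq_cvg; apply: nearW.
by move=> m; exact: etrans (esym (E2 m j i)) (esym (adde0 _)).
Qed.

End bump.

(** * The Aronsson equation *)

Section E_inf_bounds.
Context {R : realType} {n : nat}.
Implicit Types (A U Omega : set 'rV[R]_n) (u v : 'rV[R]_n -> R) (H : jet R n -> R).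
Local Notation mu := (lebesgue_rV R n).

Lemma E_inf_le H A v (m : R) : open A -> Ck setT A 2 v ->
  (forall x, A x -> H (J2 v x) <= m) -> (E_inf H A v A <= m%:E)%E.
Proof.
move=> oA Cv Hm; apply/ess_supP.
apply: filterS (weak_J2E oA Cv) => x E.
rewrite /patch; case: ifPn => [|_]; last exact: leNye.
by rewrite inE => Ax; rewrite E// lee_fin; exact: Hm.
Qed.

(** Otherwise [h] would exceed the essential supremum on a neighbourhood of [z], which meets [A] in
    a nonempty open set, hence in positive measure. Allowing [z] in the closure covers maxima on the
    sphere. *)
Lemma E_inf_ge H Omega A u (z : 'rV[R]_n) (h : 'rV[R]_n -> R) :
  open Omega -> Ck setT Omega 2 u -> open A -> A `<=` Omega -> closure A z ->
  (forall x, A x -> H (J2 u x) = h x) -> {for z, continuous h} ->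
  ((h z)%:E <= E_inf H Omega u A)%E.
Proof.
move=> oO Cu oA AO Az Hh ch; rewrite leNgt; apply/negP => lt_h.
(* A real threshold is needed: if the essential supremum is minus infinity, [h z - 1] serves. *)
have [t [tz Et]] : exists t : R, t < h z /\ (E_inf H Omega u A <= t%:E)%E.
  move: lt_h; case: (E_inf H Omega u A) => [r| |] //=.
    by rewrite lte_fin => rh; exists r.
  by move=> _; exists (h z - 1); rewrite gtrBl ltr01 leNye.
have /nbhs_ballP[e /= e0 ze] : \forall x \near z, t < h x by exact: cvgr_gt ch _ tz.
pose V := A `&` ball z e.
have oV : open V by apply: openI => //; exact: ball_open.
have V0 : V !=set0 by exact: Az (nbhsx_ballx z e e0).
have : {ae mu, forall x, ~ V x}.
  move/ess_supP : Et => Et; apply: filterS2 Et (weak_J2E oO Cu) => x + E [Ax /ze tx].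
  by rewrite /patch mem_set// E ?lee_fin; [rewrite Hh// leNgt tx|exact: AO].
move=> nV; have := open_gt0 oV V0.
suff -> : mu V = 0%E by rewrite ltxx.
apply/negligibleP; first exact: measurable_open.
by apply: negligibleS nV => x Vx /=; apply.
Qed.

End E_inf_bounds.

Section tensor.
Context {R : realType} {n : nat}.
Local Notation jetV := ('rV[R]_n * R * 'rV[R]_n * 'M[R]_n)%type.

Definition tensor (v : 'rV[R]_n) : jetV :=
  (0, 0, 0, \matrix_(i, j) (v ord0 i * v ord0 j)).

Lemma tensorZ (k : R) v : tensor (k *: v) = k ^+ 2 *: tensor v.
Proof.
rewrite /tensor !scale_pairE !scaler0; congr (_, _, _, _).
by apply/matrixP => i j; rewrite !mxE; ring.
Qed.

Lemma sym_add (a b : jetV) : a.2^T = a.2 -> b.2^T = b.2 -> (a + b).2^T = (a + b).2.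
Proof. by move=> aT bT; rewrite -[(a + b).2]/(a.2 + b.2) linearD /= aT bT. Qed.

Lemma tensor_sum v : tensor v = \sum_i \sum_j (v ord0 i * v ord0 j) *:
  ((0, 0, 0, delta_mx i j) : jetV).
Proof.
pose f (M : 'M[R]_n) : jetV := (0, 0, 0, M).
have fE k M N : f (k *: M + N) = k *: f M + f N.
  by rewrite /f scale_pairE add_pairE !scaler0 addr0.
have f0 : f 0 = 0 by [].
have fD M N : f (M + N) = f M + f N by rewrite -[M in LHS]scale1r fE scale1r.
have fZ k M : f (k *: M) = k *: f M by rewrite -[k *: M]addr0 fE f0 addr0.
rewrite -[LHS]/(f _) [X in f X]matrix_sum_delta.
rewrite (big_morph f fD f0); apply: eq_bigr => i _.
rewrite (big_morph f fD f0); apply: eq_bigr => j _.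
by rewrite fZ mxE.
Qed.

End tensor.

(** A point [z] is approached along the segment towards the centre, whose points [c t] with
    [0 < t < 1] are interior. *)
Lemma ecball_closure {R : realType} {n : nat} (x0 : 'rV[R]_n) (r : R) :
  0 < r -> ecball x0 r `<=` closure (eball x0 r).
Proof.
move=> r0 z Kz B zB.
pose c (t : R) : 'rV[R]_n := z + t *: (x0 - z).
have cc : {for (0 : R), continuous c}.
  have c1 : {for (0 : R), continuous (fun _ : R => z)} by exact: cst_continuous.
  have c2 : {for (0 : R), continuous (fun t : R => t *: (x0 - z))} by exact: scalel_continuous.
  exact: cvgD c1 c2.
have c0 : c 0 = z by rewrite /c scale0r addr0.
have nB : \forall t \near (0 : R)^'+, B (c t).
  by apply: cvg_within; apply: cc; rewrite c0.
have /filter_ex[t [[t0 t1] Bt]] : \forall t \near (0 : R)^'+, (0 < t /\ t < 1) /\ B (c t).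
  apply: filterI nB; apply: filterI; first exact: nbhs_right_gt.
  exact: nbhs_right_lt.
exists (c t); split => //.
have E : c t - x0 = (1 - t) *: (z - x0).
  by apply/rowP => i; rewrite !mxE; ring.
have Tr : dotr (z - x0) (z - x0) <= r by move: Kz; rewrite /ecball /= subr_ge0.
have T0 := dotr_ge0 (z - x0).
have -> : eball x0 r (c t) = (0 < r - (1 - t) ^+ 2 * dotr (z - x0) (z - x0)) :> Prop.
  rewrite /eball /= /sqgap E; congr (is_true (0 < r - _)).
  by rewrite /dotr mulr_sumr; apply: eq_bigr => i _; rewrite !mxE; ring.
move: (dotr _ _) Tr T0 => T Tr T0.
have : (1 - t) ^+ 2 * T <= (1 - t) ^+ 2 * r by rewrite ler_wpM2l// sqr_ge0.
have c1 : (1 - t) ^+ 2 < 1 by nra.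
by rewrite -(ltr_pM2r r0) mul1r in c1; lra.
Qed.

(** * The jet of the bump *)

Section bump_jet.
Context {R : realType} {n : nat}.
Variables (x0 : 'rV[R]_n) (r : R).
Implicit Types (b d : R) (y z : 'rV[R]_n).
Local Notation s := (sqgap x0 r).
Local Notation jetV := ('rV[R]_n * R * 'rV[R]_n * 'M[R]_n)%type.

(** The base-point entry is [0]: added to [J2 u y], this gives the jet of the sum at the same
    point. *)
Definition bump_jet b y : jetV := (0, sqbump x0 r b y,
  \row_i partial i (sqbump x0 r b) y, \matrix_(i, j) partial i (partial j (sqbump x0 r b)) y).

Let is_derive_sqr b (t : R) : is_derive t (1 : R) (fun t => b * t ^+ 2) (b * (2 * t)).
Proof.
by have d := is_deriveZ b (is_derive_expr2 t); apply: (is_derive_eq d).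
Qed.

Let is_derive_lin b (t : R) : is_derive t (1 : R) (fun t => b * (2 * t)) (b * 2).
Proof.
have d2 := is_deriveZ b (is_deriveZ 2 (is_derive_id t (1 : R))).
by apply: is_derive_eq d2 _; rewrite [LHS]mulrA mulr1.
Qed.

Lemma partial_bump b i y :
  partial i (sqbump x0 r b) y = b * (- 4 * s y * (y - x0) ord0 i).
Proof.
rewrite -[sqbump _ _ _]/((fun t => b * t ^+ 2) \o s).
by rewrite (partial_radial x0 r i (is_derive_sqr b)); ring.
Qed.

Lemma partial2_bump b i j y : partial i (partial j (sqbump x0 r b)) y =
  b * (8 * (y - x0) ord0 i * (y - x0) ord0 j - 4 * s y * (i == j)%:R).
Proof.
rewrite -[sqbump _ _ _]/((fun t => b * t ^+ 2) \o s).
by rewrite (partial2_radial x0 r i j (is_derive_sqr b) (is_derive_lin b)); ring.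
Qed.

(** Absorbs the deformation parameter into the amplitude, so that the deformed jet is the jet of an
    admissible competitor. *)
Lemma bump_jetZ d b y : d *: bump_jet b y = bump_jet (d * b) y.
Proof.
rewrite /bump_jet !scale_pairE scaler0; congr (_, _, _, _).
- by rewrite /sqbump -mulrA.
- by apply/rowP => i; rewrite [LHS]mxE [in LHS]mxE [RHS]mxE !partial_bump mulrA.
- by apply/matrixP => i j; rewrite [LHS]mxE [in LHS]mxE [RHS]mxE !partial2_bump mulrA.
Qed.

Lemma bump_jet_sym b y : (bump_jet b y).2^T = (bump_jet b y).2.
Proof.
apply/matrixP => i j; rewrite [LHS]mxE [LHS]mxE [RHS]mxE !partial2_bump.
by rewrite eq_sym; ring.
Qed.

Lemma continuous_bump_jet b : continuous (bump_jet b).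
Proof.
have sb : smooth (sqbump x0 r b) by exact: smooth_bump.
have sp j : smooth (partial j (sqbump x0 r b)) by exact: (smoothP sb 0).2.
have spp i j : smooth (partial i (partial j (sqbump x0 r b))) by exact: (smoothP (sp j) 0).2.
move=> y; apply: continuous_pair.
  apply: continuous_pair.
    have c0 : {for y, continuous (fun _ : 'rV[R]_n => (0 : 'rV[R]_n))}.
      exact: cst_continuous.
    have c1 : {for y, continuous (sqbump x0 r b)} by exact: smooth_continuous sb y.
    exact: continuous_pair c0 c1.
  apply: continuous_mx => i j.
  rewrite (_ : (fun _ => _) = partial j (sqbump x0 r b)).
    exact: smooth_continuous (sp j) y.
  by apply/funext => z; rewrite mxE.
apply: continuous_mx => i j.
rewrite (_ : (fun _ => _) = partial i (partial j (sqbump x0 r b))).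
  exact: smooth_continuous (spp i j) y.
by apply/funext => z; rewrite mxE.
Qed.

(** The factor [s] annihilates the value, the gradient and the identity part of the Hessian; the
    rank-one part remains. *)
Lemma bump_jet_boundary b z : s z = 0 -> bump_jet b z = (8 * b) *: tensor (z - x0).
Proof.
move=> z0; rewrite /bump_jet /tensor !scale_pairE !scaler0; congr (_, _, _, _).
- by rewrite /sqbump z0 expr0n mulr0.
- by apply/rowP => i; rewrite [LHS]mxE [RHS]mxE partial_bump z0; ring.
- apply/matrixP => i j; rewrite [LHS]mxE [RHS]mxE partial2_bump z0.
  by rewrite [in RHS]mxE; ring.
Qed.

End bump_jet.

(** * The sign of the quadratic form and the contradiction with minimality *)

Section conclusion.
Context {R : realType} {n : nat}.
Local Notation jetV := ('rV[R]_n * R * 'rV[R]_n * 'M[R]_n)%type.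
Variables (Omega : set 'rV[R]_n) (H : jet R n -> R) (u : 'rV[R]_n -> R).
Hypotheses (oO : open Omega) (CH : C1_hamiltonian Omega H) (Cu : Ck setT Omega 3 u).

Let G : jetV -> R := H \o symmetrize.
Let D : set jetV := [set a | Omega a.1.1.1].
Let oD : open D. Proof. exact: open_jet_domain. Qed.
Let CG : Ck setT D 1 G. Proof. exact: Ck_symmetrize. Qed.
Let h : 'rV[R]_n -> R := G \o J2 u.

Let G_sym (a : jetV) : a.2^T = a.2 -> H a = G a.
Proof. by move=> aT; rewrite /G /= symmetrize_id. Qed.

Let hE y : Omega y -> H (J2 u y) = h y.
Proof. by move=> Oy; apply: G_sym; exact: J2_sym oO Cu _ Oy. Qed.

Let partial_h i y : Omega y -> partial i (fun y => H (J2 u y)) y = partial i h y.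
Proof.
move=> Oy; apply: near_eq_derive.
by apply: filterS (open_nbhs_nbhs (conj oO Oy)) => z; exact: hE.
Qed.

Let G_diff y : Omega y -> differentiable G (J2 u y).
Proof. by move=> Oy; apply: jet_diff oD CG _. Qed.

Let h_diff y : Omega y -> differentiable h y /\
  forall v, 'd h y v = 'd G (J2 u y) (dJ2 u v y).
Proof.
move=> Oy; have [dJ dJE] := J2_diff oO Cu Oy.
split; first exact: differentiable_comp dJ (G_diff Oy).
by move=> v; rewrite (diff_comp dJ (G_diff Oy)) /= dJE.
Qed.

Let grad y : 'rV[R]_n := \row_i partial i h y.

Let grad_dotr y v : Omega y -> 'd h y v = dotr v (grad y).
Proof.
move=> Oy; have [dh _] := h_diff Oy.
rewrite {1}[v]row_sum_delta linear_sum; apply: eq_bigr => i _.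
by rewrite linearZ /= [grad y ord0 i]mxE /partial (deriveE _ dh).
Qed.

(** Differentiating [G] along a matrix unit is differentiating [H] along its symmetric part, which
    is precisely the entry of [H_X]. *)
Let H_X_tensor y v : Omega y ->
  'd G (J2 u y) (tensor v) = \sum_i \sum_j H_X H (J2 u y) i j * v ord0 i * v ord0 j.
Proof.
move=> Oy; rewrite tensor_sum linear_sum; apply: eq_bigr => i _.
rewrite linear_sum; apply: eq_bigr => j _.
rewrite linearZ -(deriveE _ (G_diff Oy)) /derive derive_symmetrize.
have -> : symmetrize (0, 0, 0, delta_mx i j) =
    (0, 0, 0, 2^-1 *: (delta_mx i j + delta_mx j i)) :> jetV.
  by rewrite /symmetrize /= trmx_delta.
rewrite symmetrize_id; last exact: J2_sym oO Cu _ Oy.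
by rewrite [H_X _ _ _ _]mxE -[LHS]/(_ * _) [LHS]mulrC mulrA.
Qed.

(** The left side of the equation written as a differential, which makes its continuity and its
    degree-two homogeneity in the gradient available. *)
Let q y : R := 'd G (J2 u y) (tensor (grad y)).

Let q_grad y k v : grad y = k *: v -> q y = k ^+ 2 * 'd G (J2 u y) (tensor v).
Proof. by rewrite /q => ->; rewrite tensorZ linearZ. Qed.

Let q_eq0 y : grad y = 0 -> q y = 0.
Proof.
move=> g0; have g00 : grad y = 0 *: (0 : 'rV[R]_n) by rewrite g0 scale0r.
by rewrite (q_grad g00) expr0n mul0r.
Qed.

Let d_bump_jet w x0 r b : sqgap x0 r w = 0 ->
  'd G (J2 u w) (bump_jet x0 r b w) = 8 * b * 'd G (J2 u w) (tensor (w - x0)).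
Proof. by move=> w0; rewrite (bump_jet_boundary _ w0) linearZ. Qed.

(** [Q] is [q x0] and [k ^+ 2 * T] is [q] at a maximum point. Their common strict sign is also that
    of [T], whatever the sign of [k]. *)
Let opposite_sign (k Q T : R) : 0 < Q * (k ^+ 2 * T) -> 8 * - Q * T < 0.
Proof.
rewrite mulrCA => kQT; suff : 0 < Q * T by nra.
by rewrite ltNge; apply/negP => QT0; move: kQT; rewrite ltNge mulr_ge0_le0// sqr_ge0.
Qed.

Let continuous_grad y : Omega y -> {for y, continuous grad}.
Proof.
move=> Oy; apply: continuous_mx => i j; rewrite (ord1 i).
have E : \forall z \near y, 'd G (J2 u z) (dJ2 u (delta_mx ord0 j) z) = grad z ord0 j.
  apply: filterS (open_nbhs_nbhs (conj oO Oy)) => z Oz.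
  by have [dh <-] := h_diff Oz; rewrite mxE /partial (deriveE _ dh).
apply: cvg_trans (near_eq_cvg E) _; rewrite -(nbhs_singleton E).
have C := @continuous_jet_diff _ _ D 0 G _ (J2 u) (dJ2 u (delta_mx ord0 j)) y oD CG Oy
  (@continuous_J2 _ _ _ _ oO Cu y Oy) (@continuous_dJ2 _ _ _ _ oO Cu _ y Oy).
exact C.
Qed.

Let continuous_q y : Omega y -> {for y, continuous q}.
Proof.
move=> Oy.
suff ct : {for y, continuous (fun z => tensor (grad z))}.
  exact (@continuous_jet_diff _ _ D 0 G _ (J2 u) (fun z => tensor (grad z)) y oD CG Oy
    (@continuous_J2 _ _ _ _ oO Cu y Oy) ct).
have c0 : {for y, continuous (fun _ : 'rV[R]_n => ((0, 0, 0) : 'rV[R]_n * R * 'rV[R]_n))}.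
  exact: cst_continuous.
apply: (continuous_pair c0); apply: continuous_mx => i j.
have -> : (fun z => (\matrix_(i, j) (grad z ord0 i * grad z ord0 j) : 'M[R]_n) i j) =
    (fun z => grad z ord0 i * grad z ord0 j) by apply/funext => z; rewrite mxE.
have cg k : {for y, continuous (fun z => grad z ord0 k)}.
  exact: continuous_comp (continuous_grad Oy) (@coord_continuous R 1 n ord0 k _).
exact: cvgM (cg i) (cg j).
Qed.

Lemma absolute_minimiser_tensor x0 : absolute_minimiser H Omega u -> Omega x0 -> q x0 = 0.
Proof.
clearbody q grad; move=> [_ umin] Ox0; apply/eqP/negPn/negP => q0.
have /nbhs_ballP[e /= e0 xe] : \forall y \near x0, 0 < q x0 * q y /\ Omega y.
  apply: filterI; last exact: open_nbhs_nbhs (conj oO Ox0).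
  have qq : 0 < q x0 * q x0 by rewrite -expr2 exprn_even_gt0.
  have cq : q x0 * q y @[y --> x0] --> q x0 * q x0.
    have c0 : {for x0, continuous (fun _ : 'rV[R]_n => q x0)} by exact: cst_continuous.
    exact: cvgM c0 (continuous_q Ox0).
  exact: cvgr_gt cq _ qq.
(* The closed Euclidean ball of radius [e / 2] lies in the open ball of radius [e] for the maximum
   norm. *)
pose r := (e / 2) ^+ 2; pose K := ecball x0 r; pose A := eball x0 r.
have r0 : 0 < r by rewrite exprn_gt0// divr_gt0.
have Kb y : K y -> ball x0 e y.
  rewrite /K /ecball/= subr_ge0 => yr; apply: ball_rV => // i.
  have : (y - x0) ord0 i ^+ 2 <= (e / 2) ^+ 2.
    apply: le_trans yr; rewrite /dotr (bigD1 i)//= expr2 lerDl.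
    by apply: sumr_ge0 => j _; rewrite -expr2 sqr_ge0.
  rewrite -[_ ^+ 2 <= _]/(_ <= _) -(real_normK (num_real ((y - x0) ord0 i))).
  rewrite ler_pXn2r// ?nnegrE// ?divr_ge0 ?(ltW e0)// => h1.
  by rewrite !mxE distrC in h1 *; apply: le_lt_trans h1 _; rewrite ltr_pdivrMr// ltr_pMr// ltr1n.
have KO y : K y -> Omega y by move=> /Kb /xe [].
have Kq y : K y -> 0 < q x0 * q y by move=> /Kb /xe [].
have cK : compact K := compact_ecball (x0 := x0) (r := r).
have ch y : Omega y -> {for y, continuous h}.
  by move=> Oy; have [dh _] := h_diff Oy; exact: differentiable_continuous dh.
have [z Kz zmax] : exists2 z, K z & forall y, K y -> h y <= h z.
  have [||z] := @EVT_max_rV R n h K _ cK.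
  - by exists x0; rewrite /K /ecball /sqgap /= subrr /dotr big1 ?subr0 ?ltW// => i _;
      rewrite mxE mul0r.
  - by apply: continuous_in_subspaceT => y; rewrite inE => /KO /ch.
  - move=> Kz zm; exists z; first exact: set_mem.
    by move=> y Ky; exact: zm y (mem_set Ky).
have gap y : K y <-> dotr (y - x0) (y - x0) <= r by rewrite /K /ecball /= subr_ge0.
have boundary w : K w -> h w = h z -> sqgap x0 r w = 0 /\ exists k, grad w = k *: (w - x0).
  move=> Kw hw; have [dh _] := h_diff (KO w Kw).
  have g0 : grad w != 0.
    apply: contraTneq (Kq w Kw) => g0.
    by rewrite (q_eq0 g0) mulr0 ltxx.
  have [wr gw] := max_ball_gradient r0 dh (fun v => grad_dotr v (KO w Kw)) g0 ((gap w).1 Kw)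
    (fun y yr => eq_ind_r (fun t => h y <= t) (zmax y ((gap y).2 yr)) hw).
  by split; [rewrite /sqgap wr subrr|exact: gw].
(* Only the sign opposite to [q x0] matters; smallness is left to the factor [d]. *)
pose b := - q x0.
have decr w : K w -> G (J2 u w) = h z -> 'd G (J2 u w) (bump_jet x0 r b w) < 0.
  move=> Kw hw; have [w0 [k gw]] := boundary w Kw hw.
  have := Kq w Kw; rewrite (q_grad gw) (d_bump_jet b w0) /b.
  exact: opposite_sign.
have DJ y : K y -> [/\ D (J2 u y), {for y, continuous (J2 u)} &
    {for y, continuous (bump_jet x0 r b)}].
  move=> Ky; split; [exact: KO| |exact: continuous_bump_jet].
  by have C := @continuous_J2 _ _ _ _ oO Cu y (KO y Ky).
have [d [d0 Hd]] : exists d : R, 0 < d /\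
    forall y, K y -> G (J2 u y + d *: bump_jet x0 r b y) <= h z - d ^+ 2.
  have df := deformation oD CG cK DJ zmax decr.
  have /filter_ex[d [d0 Hd]] : \forall d \near (0 : R)^'+, 0 < d /\
      forall y, K y -> G (J2 u y + d *: bump_jet x0 r b y) <= h z - d ^+ 2.
    by apply: filterI df; exact: nbhs_right_gt.
  by exists d.
have oA : open A := open_eball (x0 := x0) (r := r).
have AK : A `<=` K := eball_ecball (x0 := x0) (r := r).
have clA : closure A `<=` K.
  have /closure_id KE : closed K by exact: closed_sqgap_ge.
  by rewrite KE; exact: closure_subset.
have AO : A `<=` Omega by move=> y /AK /KO.
have Cu2 := Ck_pred Cu.
pose phi := sqbump x0 r (d * b).
have Cphi : Ck setT A 2 phi.
  by apply: (@Ck_subset _ _ setT); [exact: subsetT|apply: smooth_Ck; exact: smooth_bump].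
have CuA : Ck setT A 2 u := Ck_subset AO Cu2.
have le1 : (E_inf H Omega u A <= E_inf H A (fun x => u x + phi x)%R A)%E.
  apply: umin; [exact: oA| | |exact: bump_W2inf0].
  - apply: subclosed_compact cK clA; exact: closed_closure.
  - by move=> y /clA /KO.
have le2 : (E_inf H A (fun x => u x + phi x)%R A <= (h z - d ^+ 2)%:E)%E.
  apply: E_inf_le; [exact: oA|exact: Ck_add|].
  move=> y Ay; rewrite (J2_add oA CuA Cphi Ay) -/(bump_jet x0 r (d * b) y) -bump_jetZ.
  rewrite G_sym; first exact: Hd (AK y Ay).
  rewrite bump_jetZ; apply: sym_add; first exact: J2_sym oO Cu _ (AO y Ay).
  exact: bump_jet_sym.
(* By [boundary] the point [z] lies on the sphere, outside [A]. *)
have zA : closure A z by exact: ecball_closure.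
have ge1 : ((h z)%:E <= E_inf H Omega u A)%E.
  apply: (E_inf_ge oO Cu2 oA AO zA); last exact: ch (KO z Kz).
  by move=> y /AO; exact: hE.
have := le_trans ge1 (le_trans le1 le2).
by rewrite lee_fin leNgt ltrBlDr ltrDl exprn_gt0.
Qed.

Lemma absolute_minimiser_solution x : absolute_minimiser H Omega u -> Omega x ->
  \sum_(i < n) \sum_(j < n) H_X H (J2 u x) i j
    * partial i (fun y => H (J2 u y)) x * partial j (fun y => H (J2 u y)) x = 0.
Proof.
move=> umin Ox; rewrite -[RHS](absolute_minimiser_tensor umin Ox) /q (H_X_tensor _ Ox).
apply: eq_bigr => i _; apply: eq_bigr => j _.
by rewrite (partial_h i Ox) (partial_h j Ox) /grad !mxE.
Qed.

End conclusion.

Theorem theorem4p3 (R : realType) (n : nat) (Omega : set 'rV[R]_n)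
    (H : jet R n -> R) (u : 'rV[R]_n -> R) :
  open Omega ->
  C1_hamiltonian Omega H ->
  Ck setT Omega 3 u ->
  absolute_minimiser H Omega u ->
  forall x : 'rV[R]_n, Omega x ->
    \sum_(i < n) \sum_(j < n)
      H_X H (J2 u x) i j
      * partial i (fun y => H (J2 u y)) x
      * partial j (fun y => H (J2 u y)) x = 0.
Proof.
move=> oO CH Cu umin x Ox; exact: absolute_minimiser_solution oO CH Cu x umin Ox.
Qed.
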